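(* There exist exactly $14$ isomorphism classes of (non-abelian) $2$-step nilpotent real Lie algebras of dimension $p\le 8$ admitting an inner product for which the corresponding simply connected Riemannian Lie group carries non-zero left-invariant Killing $2$-forms: - $p=5$: $\mathbb R^2\oplus\mathfrak h_3$; - $p=6$: $\mathbb R^3\oplus\mathfrak h_3$ and $\mathfrak h_3^{\mathbb C}$; - $p=7$: $\mathbb R\oplus\mathfrak h_3^{\mathbb C}$ and $\mathbb R^2\oplus\mathfrak h$, where $\mathfrak h\in\mathcal N_5$; - $p=8$: $\mathbb R^2\oplus\mathfrak h$, where $\mathfrak h\in\mathcal N_6$.
   Context: A real finite-dimensional Lie algebra is $2$-step nilpotent if it is non-abelian and its commutator is contained in its center. $\mathcal N_p$ denotes the set of isomorphism classes of $p$-dimensional real $2$-step nilpotent Lie algebras; it is known that $\mathcal N_1=\mathcal N_2=\emptyset$, $\mathcal N_3=\{\mathfrak h_3\}$, $\mathcal N_4=\{\mathbb R\oplus\mathfrak h_3\}$, $|\mathcal N_5|=3$ and $|\mathcal N_6|=7$. Here $\mathfrak h_3$ is the real $3$-dimensional Heisenberg Lie algebra, $\mathbb R^k$ the abelian Lie algebra of dimension $k$, and $\mathfrak h_3^{\mathbb C}$ the real $6$-dimensional Lie algebra underlying the complex Heisenberg Lie algebra; it has a basis $e_1,\dots,e_4,z_1,z_2$ with non-zero brackets $[e_1,e_3]=z_1=-[e_2,e_4]$, $[e_2,e_3]=z_2=[e_1,e_4]$. Given an inner product on a Lie algebra $\mathfrak n$, the corresponding simply connected Riemannian Lie group is the simply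 connected Lie group $N$ with Lie algebra $\mathfrak n$, with the induced left-invariant Riemannian metric $g$. A Killing $k$-form on a Riemannian manifold is a differential $k$-form $\alpha$ with $\nabla_Y\alpha=\frac1{k+1}\,Y\lrcorner\, d\alpha$ for every vector field $Y$ ($\nabla$ the Levi-Civita connection, $\lrcorner$ contraction). A form is left-invariant if it is preserved by all left translations. *)

(* Defs.v *)
From HB Require Import structures.
From mathcomp Require Import all_boot all_order all_algebra.
From mathcomp Require Import ring.
From mathcomp Require Import all_classical all_reals all_analysis.

Set Implicit Arguments.
Unset Strict Implicit.
Unset Printing Implicit Defensive.

Import Order.TTheory GRing.Theory Num.Theory.
Import numFieldNormedType.Exports.

Local Open Scope classical_set_scope.
Local Open Scope ring_scope.

Record lieAlgebra (R : realType) := LieAlgebra {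
  lie_carrier :> vectType R;
  lie_br : lie_carrier -> lie_carrier -> lie_carrier;
  lie_br_bilinear : bilinear_for *:%R *:%R lie_br;
  lie_br_alt : forall x, lie_br x x = 0;
  lie_br_jacobi : forall x y z,
    lie_br x (lie_br y z) + lie_br y (lie_br z x) + lie_br z (lie_br x y) = 0
}.

Notation "[< x , y >]" := (lie_br x y)
  (at level 0, x, y at level 99, format "[<  x ,  y  >]") : ring_scope.

Definition lie_dim (R : realType) (n : lieAlgebra R) : nat := \dim {:n}.

Definition lie_abelian (R : realType) (n : lieAlgebra R) : Prop :=
  forall x y : n, [< x, y >] = 0.

Definition lie_center (R : realType) (n : lieAlgebra R) : set n :=
  [set z | forall x : n, [< z, x >] = 0].

(* The commutator is the linear span of the brackets and the center is a
   subspace, so the inclusion need only be required for the brackets. *)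
Definition two_step (R : realType) (n : lieAlgebra R) : Prop :=
  ~ lie_abelian n /\ forall x y : n, lie_center [< x, y >].

Definition lie_iso (R : realType) (n m : lieAlgebra R) : Prop :=
  exists2 f : {linear n -> m},
    bijective f & forall x y : n, f [< x, y >] = [< f x, f y >].

(* The Lie algebras satisfying P form exactly k isomorphism classes, with
   representatives L 0, ..., L (k - 1). *)
Definition iso_classes_eq (R : realType) (P : lieAlgebra R -> Prop) (k : nat) :
    Prop :=
  exists L : 'I_k -> lieAlgebra R,
    (forall i j, lie_iso (L i) (L j) -> i = j) /\
    (forall n, P n <-> exists i, lie_iso n (L i)).

(* n represents an element of N_p *)
Definition in_N (R : realType) (p : nat) (n : lieAlgebra R) : Prop :=
  two_step n /\ lie_dim n = p.

Section Examples.
Variable R : realType.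

Section Sum.
Variables n m : lieAlgebra R.

Definition sum_br (x y : n * m) : n * m := ([< x.1, y.1 >], [< x.2, y.2 >]).

Lemma sum_br_bilinear : bilinear_for *:%R *:%R sum_br.
Proof.
have [nl nr] := @lie_br_bilinear R n; have [ml mr] := @lie_br_bilinear R m.
by split=> z a x y; rewrite /sum_br; congr pair; rewrite /= ?nl ?nr ?ml ?mr.
Qed.

Lemma sum_br_alt x : sum_br x x = 0.
Proof. by rewrite /sum_br !lie_br_alt. Qed.

Lemma sum_br_jacobi x y z :
  sum_br x (sum_br y z) + sum_br y (sum_br z x) + sum_br z (sum_br x y) = 0.
Proof. by congr pair; apply: lie_br_jacobi. Qed.

Definition lie_sum : lieAlgebra R :=
  LieAlgebra sum_br_bilinear sum_br_alt sum_br_jacobi.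
End Sum.

Section Abelian.
Variable k : nat.

Definition ab_br (x y : 'rV[R]_k) : 'rV[R]_k := 0.

Lemma ab_br_bilinear : bilinear_for *:%R *:%R ab_br.
Proof. by split=> z a x y; rewrite /ab_br /= scaler0 addr0. Qed.

Lemma ab_br_jacobi x y z :
  ab_br x (ab_br y z) + ab_br y (ab_br z x) + ab_br z (ab_br x y) = 0.
Proof. by rewrite /ab_br !addr0. Qed.

Definition lie_ab : lieAlgebra R :=
  LieAlgebra ab_br_bilinear (fun=> erefl) ab_br_jacobi.
End Abelian.

Definition h3_br (x y : 'rV[R]_3) : 'rV[R]_3 :=
  (x 0 0 * y 0 1 - x 0 1 * y 0 0) *: delta_mx 0 (inord 2).

Lemma h3_br_bilinear : bilinear_for *:%R *:%R h3_br.
Proof.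
by split=> z a x y; rewrite /h3_br /= scalerA -scalerDl !mxE; congr (_ *: _); ring.
Qed.

Lemma h3_br_alt x : h3_br x x = 0.
Proof. by rewrite /h3_br mulrC subrr scale0r. Qed.

Lemma h3_br_jacobi x y z :
  h3_br x (h3_br y z) + h3_br y (h3_br z x) + h3_br z (h3_br x y) = 0.
Proof.
rewrite /h3_br !mxE /= -!(inj_eq val_inj) /= !inordK //=.
by rewrite !mulr0 !subrr !scale0r !addr0.
Qed.

Definition h3 : lieAlgebra R :=
  LieAlgebra h3_br_bilinear h3_br_alt h3_br_jacobi.

(* The basis e_1, ..., e_4, z_1, z_2 is the standard basis of R^6 with
   indices 0, ..., 5. *)
Definition h3C_br (x y : 'rV[R]_6) : 'rV[R]_6 :=
  let X i := x 0 (inord i) in let Y i := y 0 (inord i) in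
  ((X 0%N * Y 2%N - X 2%N * Y 0%N) - (X 1%N * Y 3%N - X 3%N * Y 1%N))
    *: delta_mx 0 (inord 4)
  + ((X 1%N * Y 2%N - X 2%N * Y 1%N) + (X 0%N * Y 3%N - X 3%N * Y 0%N))
    *: delta_mx 0 (inord 5).

Lemma h3C_br_bilinear : bilinear_for *:%R *:%R h3C_br.
Proof.
by split=> z a x y; apply/rowP=> k; rewrite /h3C_br !mxE; ring.
Qed.

Lemma h3C_br_alt x : h3C_br x x = 0.
Proof.
rewrite /h3C_br; set a := (X in X *: _ + _); set b := (X in _ + X *: _).
have -> : a = 0 by rewrite /a; ring.
have -> : b = 0 by rewrite /b; ring.
by rewrite !scale0r addr0.
Qed.

Lemma h3C_br_jacobi x y z :
  h3C_br x (h3C_br y z) + h3C_br y (h3C_br z x) + h3C_br z (h3C_br x y) = 0.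
Proof.
have H u v w : h3C_br u (h3C_br v w) = 0.
  rewrite /h3C_br !mxE /= -!(inj_eq val_inj) /= !inordK //=.
  by rewrite !(mulr0, addr0, subrr, scale0r).
by rewrite !H !addr0.
Qed.

Definition h3C : lieAlgebra R :=
  LieAlgebra h3C_br_bilinear h3C_br_alt h3C_br_jacobi.

End Examples.

(** * The simply connected Lie group of a 2-step nilpotent Lie algebra

  For n two-step nilpotent, exp is a diffeomorphism from n onto the simply
  connected Lie group N, and the Baker-Campbell-Hausdorff formula gives the
  group law of N in the global chart exp. So N is the manifold n with this law,
  its tangent spaces are all n, and a tensor field is a map from n to the
  tensors on n. *)

Section Geometry.
Variables (R : realType) (n : lieAlgebra R).
Implicit Types (a x y u v w : n).

Definition grp_mul x y : n := x + y + 2^-1 *: [< x, y >].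
Definition grp_inv x : n := - x.

(* The differential of the left translation by a, at any point: left
   translations are affine maps, see [grp_mulDr]. *)
Definition dL a v : n := v + 2^-1 *: [< a, v >].

Definition dird (f : n -> R) x v : R := derive1 (fun t : R => f (x + t *: v)) 0.

Definition inner_product (ip : n -> n -> R) : Prop :=
  [/\ bilinear_for *%R *%R ip,
      forall u v, ip u v = ip v u &
      forall u, u != 0 -> 0 < ip u u].

(* The left-invariant Riemannian metric which is ip at the identity. *)
Definition left_metric (ip : n -> n -> R) x u v : R :=
  ip (dL (grp_inv x) u) (dL (grp_inv x) v).

(* A connection is given in the global chart by its Christoffel symbols:
   G x u v is the covariant derivative at x, in the direction u, of the
   constant vector field v. The Levi-Civita connection is the unique
   torsion-free one for which the metric g is parallel. *)
Definition levi_civita (g : n -> n -> n -> R) (G : n -> n -> n -> n) : Prop :=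
  [/\ forall x, bilinear_for *:%R *:%R (G x),
      forall x u v, G x u v = G x v u &
      forall x u v w,
        dird (fun y => g y v w) x u = g x (G x u v) w + g x v (G x u w)].

Definition is_2form (al : n -> n -> n -> R) : Prop :=
  forall x, bilinear_for *%R *%R (al x) /\ forall u, al x u u = 0.

(* Left-invariance makes al x u v polynomial in x, so that left-invariant
   2-forms are smooth. *)
Definition left_invariant (al : n -> n -> n -> R) : Prop :=
  forall a x u v, al (grp_mul a x) (dL a u) (dL a v) = al x u v.

Definition cov_deriv (G : n -> n -> n -> n) (al : n -> n -> n -> R) x u v w : R :=
  dird (fun y => al y v w) x u - al x (G x u v) w - al x v (G x u w).

Definition ext_deriv (al : n -> n -> n -> R) x u v w : R :=
  dird (fun y => al y v w) x u - dird (fun y => al y u w) x v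
  + dird (fun y => al y u v) x w.

(* Both sides depend on the vector field Y only through its value at x. *)
Definition killing_2form (g : n -> n -> n -> R) (al : n -> n -> n -> R) : Prop :=
  is_2form al /\
  exists2 G, levi_civita g G &
    forall (Y : n -> n) x v w,
      cov_deriv G al x (Y x) v w = (2 + 1)^-1 * ext_deriv al x (Y x) v w.

Definition has_left_invariant_killing_2form : Prop :=
  exists2 ip, inner_product ip &
    exists al, [/\ killing_2form (left_metric ip) al, left_invariant al &
      exists x u v, al x u v != 0].

(** The model is indeed a group with Lie algebra n. *)

Let brDr x y z : [< x, y + z >] = [< x, y >] + [< x, z >] :> n.
Proof. by have := (lie_br_bilinear n).2 x 1 y z; rewrite /= !scale1r. Qed.

Let brDl x y z : [< x + y, z >] = [< x, z >] + [< y, z >] :> n.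
Proof. by have := (lie_br_bilinear n).1 z 1 x y; rewrite /= !scale1r. Qed.

Let brZl (c : R) x y : [< c *: x, y >] = c *: [< x, y >] :> n.
Proof.
have br0 : [< 0, y >] = 0 :> n by apply: (addrI [< 0, y >]); rewrite -brDl !addr0.
by have := (lie_br_bilinear n).1 y c x 0; rewrite /= !addr0 br0 addr0.
Qed.

Let brC x y : [< x, y >] = - [< y, x >] :> n.
Proof.
apply/eqP; rewrite -addr_eq0; have := lie_br_alt (x + y).
by rewrite brDl !brDr !lie_br_alt add0r addr0 => ->.
Qed.

Let brZr (c : R) x y : [< x, c *: y >] = c *: [< x, y >] :> n.
Proof. by rewrite brC brZl -scalerN -brC. Qed.

Lemma grp_mulDr a x v : grp_mul a (x + v) = grp_mul a x + dL a v.
Proof.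
by rewrite /grp_mul /dL brDr scalerDr !addrA; congr (_ + _); rewrite addrAC.
Qed.

Lemma grp_mulxV x : grp_mul x (grp_inv x) = 0.
Proof.
by rewrite /grp_mul /grp_inv subrr add0r -scaleN1r brZr lie_br_alt !scaler0.
Qed.

Lemma grp_mulA x y z :
  two_step n -> grp_mul x (grp_mul y z) = grp_mul (grp_mul x y) z.
Proof.
move=> n2.
have c u v w : [< [< u, v >], w >] = 0 :> n by have [_ ->] := n2.
have c' u v w : [< w, [< u, v >] >] = 0 :> n by rewrite brC c oppr0.
rewrite /grp_mul !brDl !brDr !brZl !brZr !c !c' !scaler0 !addr0 !scalerDr !addrA.
set p := _ *: [< x, y >]; set q := _ *: [< x, z >]; set r := _ *: [< y, z >].
by rewrite -!addrA; do 2 congr (_ + _); rewrite !addrA [p + z]addrC;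
  rewrite -!addrA; congr (_ + _); rewrite addrCA; congr (_ + _); rewrite addrC.
Qed.

(* dL x v is, as a function of x, the left-invariant vector field with value v
   at the identity, and dL (x + t) v - dL x v is its derivative at x in the
   direction t. So the Lie bracket of the fields defined by u and v is the one
   defined by [u, v]. *)
Lemma dL_bracket x u v : two_step n ->
  (dL (x + dL x u) v - dL x v) - (dL (x + dL x v) u - dL x u)
  = dL x [< u, v >].
Proof.
move=> n2.
have c s t w : [< [< s, t >], w >] = 0 :> n by have [_ ->] := n2.
have c' s t w : [< w, [< s, t >] >] = 0 :> n by rewrite brC c oppr0.
have e s w : dL (x + dL x s) w - dL x w = 2^-1 *: [< s, w >].
  rewrite /dL !brDl brZl c scaler0 addr0 scalerDr addrA.
  by rewrite [X in X - _ = _]addrC addrK.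
rewrite !e [ [< v, u >] ]brC scalerN opprK -scalerDl.
rewrite /dL c' scaler0 addr0 [X in X *: _](_ : _ = 1) ?scale1r //.
by rewrite -mulr2n -[_ *+ 2]mulr_natr mulVf ?pnatr_eq0.
Qed.

End Geometry.

(* Main.v *)
From HB Require Import structures.
Require Import Defs.
From mathcomp Require Import all_boot all_order all_algebra.
From mathcomp Require Import ring lra zify.
From mathcomp Require Import all_classical all_reals all_analysis.

(** Identify a left-invariant 2-form with the skew operator A such that its
    value at the identity is (u, v) |-> <A u, v>. Both sides of the Killing
    equation are left-invariant, so that it is enough to look at the identity,
    where the Koszul formula turns it into the vanishing of a cubic expression
    in u, w and A. Polarizing this expression with central arguments shows that
    A is Killing if and only if
      A [u, v] = 3 [A u, v]   for all u, v
    ([killing_form_operator], [operator_killing_form]); then A preserves the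
    center Z, and [u, A v] = [A u, v], in particular [u, A u] = 0.

    Let D be the derived algebra, and suppose A <> 0. If all values of A are
    central, then D lies in the kernel of A, so that the image of A, which has
    dimension at least 2, is a subspace of Z independent from D: the algebra has
    an abelian factor of dimension 2. Otherwise some bracket [A x, y] is not 0.
    Then x, A x, y, A y are independent modulo Z and [x, y], [A x, y] are
    independent elements of Z. In dimension at most 8 the corank dim n / Z is
    thus 4, 5 or 6. In corank 4 the operator A is, up to scale, multiplication
    by i on the first four elements and by 3 i on the last two, and these span a
    complex Heisenberg algebra. Corank 5 is impossible because a skew operator
    on the orthogonal of Z is then singular, and corank 6 because it would give
    a nondegenerate complex alternating form on C^3. This is
    [killing_dichotomy]. Conversely, a rotation of a 2-dimensional abelian
    factor, or multiplication by i and 3 i on the complex Heisenberg algebra, is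
    a Killing operator.

    It remains to classify two-step nilpotent algebras with
    dim n / Z + dim D <= 6, up to an abelian factor. This class contains those
    of dimension at most 6, and those of dimension at most 8 with an abelian
    factor of dimension 2. There are seven of them ([classify]). The only long
    case is dim n / Z = 4, dim D = 2, a pencil of alternating forms on R^4: its
    Pfaffian is an indefinite, degenerate or definite quadratic form, and these
    three types are told apart by the elements x for which ad x has rank one,
    which correspond to the degenerate forms of the pencil. The same elements,
    the condition dim D = 1 and the dimensions of n and of Z separate the models
    ([model_iso_inj]). *)

Set Implicit Arguments.
Unset Strict Implicit.
Unset Printing Implicit Defensive.

Import Order.TTheory GRing.Theory Num.Theory.
Import numFieldNormedType.Exports.

Local Open Scope ring_scope.

(** * Brackets, center and derived algebra *)

(** Reduces identities between vectors to identities between scalars, which ring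
    and field decide. *)
Lemma scalar_ext (R : realType) (V : vectType R) (u v : V) :
  (forall phi : {scalar V}, phi u = phi v) -> u = v.
Proof.
move=> H; rewrite (coord_vbasis (memvf u)) (coord_vbasis (memvf v)).
by apply: eq_bigr => i _; rewrite (H (coord (vbasis {:V}) i)).
Qed.

Lemma scalarE (R : realType) (V : vectType R) (phi : {scalar V}) :
  [/\ phi 0 = 0, forall u v, phi (u + v) = phi u + phi v,
      forall u, phi (- u) = - phi u & forall c u, phi (c *: u) = c * phi u].
Proof.
by split=> *; rewrite ?linear0 ?linearD ?linearN //; apply: linearZ.
Qed.

Ltac vsimp := let phi := fresh "phi" in
  apply: scalar_ext => phi;
  let E0 := fresh in let ED := fresh in let EN := fresh in let EZ := fresh in
  have [E0 ED EN EZ] := scalarE phi; rewrite ?(E0, ED, EN, EZ); clear E0 ED EN EZ.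
Ltac vring := vsimp; ring.
Ltac vfield := vsimp; field.

Section Bracket.
Variables (R : realType) (n : lieAlgebra R).
Implicit Types (x y z : n) (c : R).

Lemma brDr x y z : [< x, y + z >] = [< x, y >] + [< x, z >] :> n.
Proof. by have := (lie_br_bilinear n).2 x 1 y z; rewrite /= !scale1r. Qed.

Lemma brDl x y z : [< x + y, z >] = [< x, z >] + [< y, z >] :> n.
Proof. by have := (lie_br_bilinear n).1 z 1 x y; rewrite /= !scale1r. Qed.

Lemma brr x : [< x, x >] = 0 :> n. Proof. exact: lie_br_alt. Qed.

Lemma brC x y : [< x, y >] = - [< y, x >] :> n.
Proof.
apply/eqP; rewrite -addr_eq0; have := brr (x + y).
by rewrite brDl !brDr !brr add0r addr0 => ->.
Qed.

Lemma br0l x : [< 0, x >] = 0 :> n.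
Proof. by apply: (addrI [< 0, x >]); rewrite -brDl !addr0. Qed.

Lemma br0r x : [< x, 0 >] = 0 :> n.
Proof. by rewrite brC br0l oppr0. Qed.

Lemma brZl c x y : [< c *: x, y >] = c *: [< x, y >] :> n.
Proof. by have := (lie_br_bilinear n).1 y c x 0; rewrite /= !addr0 br0l addr0. Qed.

Lemma brZr c x y : [< x, c *: y >] = c *: [< x, y >] :> n.
Proof. by rewrite brC brZl -scalerN -brC. Qed.

Lemma brNl x y : [< - x, y >] = - [< x, y >] :> n.
Proof. by rewrite -scaleN1r brZl scaleN1r. Qed.

Lemma brNr x y : [< x, - y >] = - [< x, y >] :> n.
Proof. by rewrite brC brNl -brC. Qed.

Definition brE := (brDl, brDr, brNl, brNr, brZl, brZr, br0l, br0r, brr).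

Lemma br_suml I (r : seq I) (F : I -> n) y :
  [< \sum_(i <- r) F i, y >] = \sum_(i <- r) [< F i, y >] :> n.
Proof. by elim/big_rec2: _ => [|i u v _ <-]; rewrite brE. Qed.

Lemma br_sumr I (r : seq I) (F : I -> n) y :
  [< y, \sum_(i <- r) F i >] = \sum_(i <- r) [< y, F i >] :> n.
Proof. by elim/big_rec2: _ => [|i u v _ <-]; rewrite brE. Qed.

Lemma lie_br_linear x : linear (lie_br x).
Proof. by move=> c y z; rewrite !brE. Qed.

HB.instance Definition _ x :=
  GRing.isLinear.Build R n n *:%R (lie_br x) (lie_br_linear x).

Definition ad x : 'End(n) := linfun (lie_br x).

Lemma adE x y : ad x y = [< x, y >]. Proof. by rewrite lfunE. Qed.

Lemma ad_linear : linear ad.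
Proof. by move=> c x y; apply/lfunP=> z; rewrite add_lfunE scale_lfunE !adE !brE. Qed.

HB.instance Definition _ := GRing.isLinear.Build R n 'End(n) *:%R ad ad_linear.

Definition centerv : {vspace n} := lker (linfun ad).

Lemma centerP z : reflect (forall x, [< z, x >] = 0 :> n) (z \in centerv).
Proof.
rewrite memv_ker lfunE /=; apply: (iffP eqP) => [H x | H].
  by rewrite -adE H zero_lfunE.
by apply/lfunP=> x; rewrite adE H zero_lfunE.
Qed.

Lemma center_brl z x : z \in centerv -> [< z, x >] = 0 :> n.
Proof. by move/centerP. Qed.

Lemma center_brr z x : z \in centerv -> [< x, z >] = 0 :> n.
Proof. by move=> H; rewrite brC center_brl // oppr0. Qed.

Lemma notin_centerP x : x \notin centerv -> exists y, [< x, y >] <> 0 :> n.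
Proof.
move=> H; apply/existsNP => K; move/negP: H; apply; apply/centerP => y.
exact: contrapT (K y).
Qed.

Definition derivedv : {vspace n} :=
  <<[seq [< x, y >] : n | x <- vbasis {:n}, y <- vbasis {:n}]>>%VS.

Lemma br_derived x y : [< x, y >] \in derivedv.
Proof.
rewrite (coord_vbasis (memvf x)) br_suml; apply: memv_suml => i _.
rewrite (coord_vbasis (memvf y)) br_sumr; apply: memv_suml => j _.
rewrite !brE !memvZ //; apply: memv_span; apply/allpairsP.
by exists ((vbasis {:n})`_i, (vbasis {:n})`_j); split=> //;
  apply: mem_nth; rewrite size_tuple.
Qed.

Lemma derived_sub (U : {vspace n}) :
  (forall x y, [< x, y >] \in U) -> (derivedv <= U)%VS.
Proof. by move=> H; apply/span_subvP => _ /allpairsP[[x y] [_ _ ->]]. Qed.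

Definition corank : nat := (\dim {:n} - \dim centerv)%N.

Lemma corankE : (corank + \dim centerv = \dim {:n})%N.
Proof. by rewrite subnK // dimvS // subvf. Qed.

(** Linear independence in the quotient by the center. The coefficients are
    indexed by nat in order to specialize them to explicit families. *)
Definition indep_mod_center (X : seq n) : Prop :=
  forall a : nat -> R, \sum_(i < size X) a i *: X`_i \in centerv ->
    forall i, (i < size X)%N -> a i = 0.

Lemma free_coef (X : seq n) : (forall a : nat -> R,
    \sum_(i < size X) a i *: X`_i = 0 -> forall i, (i < size X)%N -> a i = 0) ->
  free X.
Proof.
move=> H; apply/(@freeP _ _ _ (in_tuple X)) => k /= e i.
have := H (fun j => if insub j is Some j' then k j' else 0).
rewrite (eq_bigr (fun i => k i *: X`_i)) => [|j _]; last by rewrite valK.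
by move=> /(_ e i (ltn_ord i)); rewrite valK.
Qed.

Lemma mem_span_coef (X : seq n) v : v \in <<X>>%VS ->
  exists a : nat -> R, v = \sum_(i < size X) a i *: X`_i.
Proof.
move=> vX.
exists (fun j => if insub j is Some j' then coord (in_tuple X) j' v else 0).
rewrite {1}(@coord_span _ _ _ (in_tuple X) v vX).
by apply: eq_bigr => i _; rewrite valK.
Qed.

Lemma indep_span X : indep_mod_center X ->
  (<<X>> :&: centerv = 0)%VS /\ free X.
Proof.
move=> H; split; last first.
  by apply: free_coef => a e; apply: H; rewrite e mem0v.
apply/eqP; rewrite -subv0; apply/subvP => v /memv_capP[/mem_span_coef[a ->] vZ].
by rewrite big1 ?mem0v // => i _; rewrite (H a vZ) ?ltn_ord // scale0r.
Qed.

Lemma indep_dim X : indep_mod_center X -> \dim (<<X>> + centerv) = (size X + \dim centerv)%N.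
Proof.
by move=> /indep_span[e /eqP fX]; rewrite dimv_disjoint_sum // fX.
Qed.

Lemma indep_cons X v : indep_mod_center X -> v \notin (<<X>> + centerv)%VS ->
  indep_mod_center (v :: X).
Proof.
move=> iX vX a; rewrite big_ord_recl /=; under eq_bigr do rewrite add0n.
move=> H; have a0 : a 0%N = 0.
  apply: contraNeq vX => a0.
  rewrite -[v](scalerK a0); apply: memvZ.
  rewrite -[_ *: v](addKr (\sum_(i < size X) a i.+1 *: X`_i)).
  rewrite [X in _ + X]addrC memv_add // memvN.
  by apply: memv_suml => i _; apply/memvZ/memv_span/mem_nth.
move: H; rewrite a0 scale0r add0r => /(iX (fun i => a i.+1)) H [|i] //.
exact: H.
Qed.

Lemma indep_seq1 v : v \notin centerv -> indep_mod_center [:: v].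
Proof. by move=> vZ; apply: indep_cons => [a _ []|] //; rewrite span_nil add0v. Qed.

Lemma indep_extend X : indep_mod_center X -> (size X < corank)%N ->
  exists v, indep_mod_center (v :: X).
Proof.
move=> iX lt; have : ~~ ({:n} <= <<X>> + centerv)%VS.
  apply: contraL lt => /dimvS; rewrite (indep_dim iX) -corankE leq_add2r.
  by rewrite -leqNgt.
by case/subvPn => v _ vX; exists v; apply: indep_cons.
Qed.

Lemma exists_complement : exists2 X, indep_mod_center X & size X = corank.
Proof.
suff H k : (k <= corank)%N -> exists2 X, indep_mod_center X & size X = k by exact: H.
elim: k => [_ | k IH lt]; first by exists [::].
have [X iX sX] := IH (ltnW lt).
by have [|v iv] := indep_extend iX; rewrite ?sX //; exists (v :: X); rewrite //= sX.
Qed.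

Lemma indep_leq X : indep_mod_center X -> (size X <= corank)%N.
Proof.
move=> /indep_dim H; rewrite -(leq_add2r (\dim centerv)) corankE -H.
exact/dimvS/subvf.
Qed.

Lemma indep_full X : indep_mod_center X -> size X = corank ->
  (<<X>> + centerv)%VS = fullv.
Proof.
move=> /indep_dim H e; apply/eqP; rewrite eqEdim subvf /= H e corankE //.
Qed.

(** The elements whose bracket with x lies in U form a subspace, and it contains
    the center. *)
Lemma br_mem_gen X x (U : {vspace n}) : indep_mod_center X -> size X = corank ->
  (forall e, e \in X -> [< x, e >] \in U) -> forall y, [< x, y >] \in U.
Proof.
move=> iX sX H y; rewrite -adE memv_preim.
suff /subvP H' : ({:n} <= ad x @^-1: U)%VS by apply/H'/memvf.
rewrite -(indep_full iX sX) subv_add; apply/andP; split; last first.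
  by apply/subvP=> z zZ; rewrite -memv_preim adE center_brr // mem0v.
by apply/span_subvP => e eX; rewrite -memv_preim adE H.
Qed.

Lemma centralP_gen X x : indep_mod_center X -> size X = corank ->
  (forall e, e \in X -> [< x, e >] = 0 :> n) -> x \in centerv.
Proof.
move=> iX sX H; apply/centerP => y; apply/eqP; rewrite -memv0.
by apply: (br_mem_gen iX sX) => e /H ->; rewrite mem0v.
Qed.

Lemma coord_gen X x : indep_mod_center X -> size X = corank ->
  exists a : nat -> R, exists2 z, z \in centerv &
    x = \sum_(i < size X) a i *: X`_i + z.
Proof.
move=> iX sX; have : x \in (<<X>> + centerv)%VS by rewrite indep_full // memvf.
by case/memv_addP => u /mem_span_coef[a ->] [z zZ ->]; exists a, z.
Qed.

Lemma dim_ker_ad x (U : {vspace n}) : (forall y, [< x, y >] \in U) ->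
  (\dim {:n} <= \dim (lker (ad x)) + \dim U)%N.
Proof.
move=> H; rewrite -(limg_ker_dim (ad x) {:n}) capfv leq_add2l dimvS //.
by apply/subvP=> _ /memv_imgP[y _ ->]; rewrite adE.
Qed.

Lemma dim_cap (U V : {vspace n}) : (\dim U + \dim V <= \dim (U :&: V) + \dim {:n})%N.
Proof. by rewrite -dimv_sum_cap addnC leq_add2l dimvS // subvf. Qed.

(** The centralizers of x and y have codimensions at most dim U and dim V, so
    that their intersection is too large to be contained in the center. *)
Lemma common_centralizer x y (U V : {vspace n}) :
  (forall w, [< x, w >] \in U) -> (forall w, [< y, w >] \in V) ->
  (\dim U + \dim V < corank)%N ->
  exists v, [/\ v \notin centerv, [< x, v >] = 0 :> n & [< y, v >] = 0 :> n].
Proof.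
move=> /dim_ker_ad dx /dim_ker_ad dy lt.
have : ~~ (lker (ad x) :&: lker (ad y) <= centerv)%VS.
  apply: contraL lt => /dimvS; have := dim_cap (lker (ad x)) (lker (ad y)).
  by have := corankE; rewrite -leqNgt; lia.
case/subvPn => v /memv_capP[]; rewrite !memv_ker !adE => /eqP ? /eqP ? ?.
by exists v; split=> //; rewrite memv_ker.
Qed.

Hypothesis n2 : two_step n.

Lemma br_center x y : [< x, y >] \in centerv.
Proof. by apply/centerP; case: n2 => _; apply. Qed.

Lemma derived_center : (derivedv <= centerv)%VS.
Proof. exact/derived_sub/br_center. Qed.

Lemma two_step_br : exists x y, [< x, y >] <> 0 :> n.
Proof.
case: n2 => nab _; apply: contrapT => H; apply: nab => x y; apply: contrapT => K.
by apply: H; exists x, y.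
Qed.

Lemma br_brl x y w : [< [< x, y >], w >] = 0 :> n.
Proof. exact/center_brl/br_center. Qed.

Lemma br_brr x y w : [< w, [< x, y >] >] = 0 :> n.
Proof. exact/center_brr/br_center. Qed.

Lemma derived_neq0 : (0 < \dim derivedv)%N.
Proof.
have [x [y /eqP xy]] := two_step_br; rewrite lt0n dimv_eq0; apply: contraNneq xy => D0.
by rewrite -memv0 -D0 br_derived.
Qed.

End Bracket.

(** * Isomorphisms *)

Section Iso.
Variable R : realType.
Implicit Types n m k : lieAlgebra R.

Lemma lie_iso_sym n m : lie_iso n m -> lie_iso m n.
Proof.
case=> f [g fK gK] fbr.
pose L := GRing.isLinear.Build R m n *:%R g (can2_linear fK gK).
pose g' : {linear m -> n} := HB.pack g L.
exists g'; first by exists f.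
by move=> x y /=; apply: (can_inj fK); rewrite fbr !gK.
Qed.

Lemma lie_iso_trans m n k : lie_iso n m -> lie_iso m k -> lie_iso n k.
Proof.
case=> f bf fbr [g bg gbr]; exists (g \o f); first exact: bij_comp.
by move=> x y /=; rewrite fbr gbr.
Qed.

Lemma lie_iso_refl n : lie_iso n n.
Proof. by exists (@idfun n : {linear n -> n}) => //; exists id. Qed.

Lemma lie_iso_dim n m : lie_iso n m -> lie_dim n = lie_dim m.
Proof.
case=> f bf _; have kf : (lker (linfun f) == 0)%VS.
  by apply/lker0P => x y; rewrite !lfunE; apply: (bij_inj bf).
rewrite /lie_dim -(limg_dim_eq (f := linfun f)); last by rewrite (eqP kf) capv0.
congr (\dim _); apply/vspaceP => y; rewrite memvf; case: bf => g fK gK.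
by rewrite -(gK y) -(lfunE f) memv_img // memvf.
Qed.

Lemma lie_iso_center n m : lie_iso n m -> \dim (centerv n) = \dim (centerv m).
Proof.
case=> f bf fbr; have kf : (lker (linfun f) == 0)%VS.
  by apply/lker0P => x y; rewrite !lfunE; apply: (bij_inj bf).
rewrite -(limg_dim_eq (f := linfun f)); last by rewrite (eqP kf) capv0.
case: bf => g fK gK; congr (\dim _); apply/vspaceP => y; apply/memv_imgP/idP.
  case=> x /centerP xZ ->; apply/centerP => w.
  by rewrite lfunE /= -(gK w) -fbr xZ linear0.
move=> /centerP yZ; exists (g y); last by rewrite lfunE /= gK.
by apply/centerP => w; apply: (can_inj fK); rewrite fbr gK yZ linear0.
Qed.

Lemma lie_iso_derived n m : lie_iso n m ->
  (\dim (derivedv m) <= \dim (derivedv n))%N.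
Proof.
case=> f bf fbr; have kf : (lker (linfun f) == 0)%VS.
  by apply/lker0P => x y; rewrite !lfunE; apply: (bij_inj bf).
rewrite -(limg_dim_eq (f := linfun f) (U := derivedv n)); last first.
  by rewrite (eqP kf) capv0.
case: bf => g fK gK; apply: dimvS; apply: derived_sub => x y.
by rewrite -(gK x) -(gK y) -fbr -(lfunE f) memv_img // br_derived.
Qed.

Lemma lie_iso_two_step n m : lie_iso n m -> two_step n -> two_step m.
Proof.
case=> f [g fK gK] fbr [nab nZ]; split=> [ab | x y w].
  by apply: nab => x y; apply: (can_inj fK); rewrite fbr ab linear0.
rewrite -(gK x) -(gK y) -(gK w) -!fbr.
by rewrite (nZ (g x) (g y) (g w)) linear0.
Qed.

Lemma lie_sum_iso n n' m m' :
  lie_iso n n' -> lie_iso m m' -> lie_iso (lie_sum n m) (lie_sum n' m').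
Proof.
case=> f [f' fK f'K] fbr [g [g' gK g'K] gbr].
pose h (u : lie_sum n m) : lie_sum n' m' := (f u.1, g u.2).
have hl : linear h by move=> a u v; rewrite /h /= !linearP.
pose L := GRing.isLinear.Build R (lie_sum n m) (lie_sum n' m') *:%R h hl.
pose h' : {linear lie_sum n m -> lie_sum n' m'} := HB.pack h L.
exists h'; last by move=> u v; rewrite /= /h /= /sum_br /= fbr gbr.
exists (fun u => (f' u.1, g' u.2)) => [[u v]|[u v]] /=; rewrite /h /=.
  by rewrite fK gK.
by rewrite f'K g'K.
Qed.

Lemma lie_iso_inj n m (f : {linear n -> m}) : injective f ->
  lie_dim n = lie_dim m -> (forall x y, f [< x, y >] = [< f x, f y >]) ->
  lie_iso n m.
Proof.
move=> fI dE fbr; exists f => //.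
have kf : (lker (linfun f) == 0)%VS by apply/lker0P => x y; rewrite !lfunE; apply: fI.
have sf y : y \in limg (linfun f).
  suff -> : limg (linfun f) = fullv by rewrite memvf.
  apply/eqP; rewrite eqEdim subvf -/(lie_dim m) -dE limg_dim_eq ?leqnn //.
  by rewrite (eqP kf) capv0.
exists ((linfun f)^-1)%VF => x; first by rewrite -[f x]lfunE lker0_lfunK.
by rewrite -[f _]lfunE limg_lfunVK.
Qed.

End Iso.

(** * Two-step nilpotent algebras given by structure forms *)

(** A shape (q, F) stands for the algebra with generators e_0, ..., e_(q-1)
    and central elements z_0, z_1, ... where [e_i, e_j] is the sum of the z_k
    such that (i, j) is listed in F_k, minus those such that (j, i) is. *)
Definition lie_shape := (nat * seq (seq (nat * nat)))%type.

Section Model.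
Variable R : realType.

(** The coordinate of index a, and 0 when there is none: in this way the indices
    of a shape need not be bounded. *)
Definition co q (x : 'rV[R]_q) (a : nat) : R :=
  \sum_(i < q) x 0 i * (i == a :> nat)%:R.

Lemma coE q (x : 'rV[R]_q) (i : 'I_q) : co x i = x 0 i.
Proof.
rewrite /co (bigD1 i) //= eqxx mulr1 big1 ?addr0 // => j ji.
by rewrite (_ : (j == i :> nat) = false) ?mulr0 //; apply/negbTE.
Qed.

Lemma coD q (x y : 'rV[R]_q) a : co (x + y) a = co x a + co y a.
Proof. by rewrite /co -big_split; apply: eq_bigr => i _; rewrite mxE mulrDl. Qed.

Lemma coZ q c (x : 'rV[R]_q) a : co (c *: x) a = c * co x a.
Proof. by rewrite /co mulr_sumr; apply: eq_bigr => i _; rewrite mxE mulrA. Qed.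

Lemma co0 q a : co (0 : 'rV[R]_q) a = 0.
Proof. by rewrite -(scale0r 0) coZ mul0r. Qed.

Lemma co_delta q (i : 'I_q) a : co (delta_mx 0 i) a = (i == a :> nat)%:R.
Proof.
rewrite /co (bigD1 i) //= mxE !eqxx mul1r big1 ?addr0 // => j ji.
by rewrite mxE (negbTE ji) mul0r.
Qed.

Lemma co_row q (f : nat -> R) a : (a < q)%N -> co (\row_(i < q) f i : 'rV[R]_q) a = f a.
Proof. by move=> lt; rewrite (coE _ (Ordinal lt)) mxE. Qed.

Lemma co_inj q (x y : 'rV[R]_q) : (forall a, (a < q)%N -> co x a = co y a) -> x = y.
Proof. by move=> H; apply/rowP => i; rewrite -!coE H. Qed.

Definition sform q (l : seq (nat * nat)) (x y : 'rV[R]_q) : R :=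
  \sum_(ab <- l) (co x ab.1 * co y ab.2 - co x ab.2 * co y ab.1).

Lemma sformC q l (x y : 'rV[R]_q) : sform l x y = - sform l y x.
Proof. by rewrite /sform -sumrN; apply: eq_bigr => ab _; ring. Qed.

Lemma sform_linear q l (x : 'rV[R]_q) c y z :
  sform l x (c *: y + z) = c * sform l x y + sform l x z.
Proof.
rewrite /sform mulr_sumr -big_split; apply: eq_bigr => ab _ /=.
by rewrite !(coD, coZ); ring.
Qed.

Definition str_const (l : seq (nat * nat)) (i j : nat) : R :=
  (count_mem (i, j) l)%:R - (count_mem (j, i) l)%:R.

Lemma sform_str_const q l (x y : 'rV[R]_q) :
  sform l x y = \sum_(i < q) \sum_(j < q) x 0 i * y 0 j * str_const l i j.
Proof.
elim: l => [|[a b] l IH].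
  rewrite /sform big_nil big1 // => i _; rewrite big1 // => j _.
  by rewrite /str_const /= subrr mulr0.
rewrite /sform big_cons -/(sform l x y) IH /co /= !mulr_suml -sumrB -big_split /=.
apply: eq_bigr => i _; rewrite !mulr_sumr -sumrB -big_split /=.
apply: eq_bigr => j _; rewrite /str_const /= !natrD !xpair_eqE.
rewrite ![a == _]eq_sym ![b == _]eq_sym.
by case: (nat_of_ord i == a); case: (nat_of_ord i == b);
  case: (nat_of_ord j == a); case: (nat_of_ord j == b) => /=; ring.
Qed.

Section Def.
Variables (s : lie_shape) (p : nat).

Definition model_br (u v : 'rV[R]_s.1 * 'rV[R]_p) : 'rV[R]_s.1 * 'rV[R]_p :=
  (0, \row_k sform (nth [::] s.2 k) u.1 v.1).

Lemma model_br_bilinear : bilinear_for *:%R *:%R model_br.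
Proof.
split=> w c u v; rewrite /model_br; congr pair => /=; rewrite ?scaler0 ?addr0 //;
  apply/rowP => k; rewrite !mxE ?sform_linear //.
by rewrite sformC sform_linear sformC [sform _ v.1 _]sformC; ring.
Qed.

Lemma model_br_alt u : model_br u u = 0.
Proof.
congr pair; apply/rowP => k; rewrite !mxE.
by rewrite /sform big1 // => ab _; rewrite mulrC subrr.
Qed.

Lemma model_br_center u v w : model_br u (model_br v w) = 0.
Proof.
congr pair; apply/rowP => k; rewrite !mxE.
by rewrite /sform big1 // => ab _; rewrite !co0 !mulr0 subrr.
Qed.

Lemma model_br_jacobi u v w :
  model_br u (model_br v w) + model_br v (model_br w u)
  + model_br w (model_br u v) = 0.
Proof. by rewrite !model_br_center !addr0. Qed.

Definition model : lieAlgebra R :=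
  LieAlgebra model_br_bilinear model_br_alt model_br_jacobi.

Lemma model_dim : lie_dim model = (s.1 + p)%N.
Proof.
rewrite /lie_dim dimvf.
by rewrite -[LHS]/(dim 'rV[R]_s.1 + dim 'rV[R]_p)%N /dim /= !mul1n.
Qed.

(** This says that the e_i are independent modulo the center of the model, which
    is then spanned by the z_k. *)
Definition nondeg_shape : Prop := forall x : 'rV[R]_s.1,
  (forall k y, (k < size s.2)%N -> sform (nth [::] s.2 k) x y = 0) -> x = 0.

Hypothesis nd : nondeg_shape.

Lemma model_center (u : model) : (size s.2 <= p)%N ->
  (u \in centerv model) = (u.1 == 0).
Proof.
move=> sp; apply/centerP/eqP => [H | u0 v]; last first.
  congr pair; apply/rowP => k; rewrite !mxE u0.
  by rewrite /sform big1 // => ab _; rewrite !co0 !mul0r subrr.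
apply: nd => k y lt.
have := congr1 (fun v : model => co v.2 k) (H ((y, 0) : model)) => /=.
rewrite (co_row (fun k => sform (nth [::] s.2 k) u.1 y)) ?co0 //.
exact: leq_trans lt sp.
Qed.

Lemma model_dim_center : (size s.2 <= p)%N -> \dim (centerv model) = p.
Proof.
move=> sp; pose f (z : 'rV[R]_p) : model := (0, z).
have fl : linear f by move=> c u v; congr pair; rewrite /= ?scaler0 ?addr0.
pose L := GRing.isLinear.Build R 'rV[R]_p model *:%R f fl.
pose f' : {linear 'rV[R]_p -> model} := HB.pack f L.
have kf : (lker (linfun f') == 0)%VS.
  by apply/lker0P => x y; rewrite !lfunE /= => -[].
suff -> : centerv model = limg (linfun f').
  by rewrite limg_dim_eq ?(eqP kf) ?capv0 // dimvf /dim /= mul1n.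
apply/vspaceP => u; rewrite model_center //; apply/eqP/memv_imgP => [u0 | [z _ ->]].
  by exists u.2; rewrite ?memvf // lfunE; case: u u0 => ? ? /= ->.
by rewrite lfunE.
Qed.

Lemma model_dim_derived : (\dim (derivedv model) <= size s.2)%N.
Proof.
pose f (z : 'rV[R]_(size s.2)) : model := (0, \row_k co z k).
have fl : linear f.
  move=> c u v; congr pair; rewrite /= ?scaler0 ?addr0 //.
  by apply/rowP => k; rewrite !mxE coD coZ.
pose L := GRing.isLinear.Build R _ model *:%R f fl.
pose f' : {linear 'rV[R]_(size s.2) -> model} := HB.pack f L.
suff /dimvS H : (derivedv model <= limg (linfun f'))%VS.
  apply: leq_trans H _; have := limg_ker_dim (linfun f') fullv.
  by rewrite dimvf [in RHS]/dim /= mul1n; lia.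
apply: derived_sub => u v; apply/memv_imgP.
exists (\row_k sform (nth [::] s.2 k) u.1 v.1); rewrite ?memvf // lfunE /= /f.
congr pair; apply/rowP => k; rewrite !mxE.
have [lt | ge] := ltnP k (size s.2).
  by rewrite (co_row (fun k => sform (nth [::] s.2 k) u.1 v.1)).
rewrite nth_default // /sform big_nil /co big1 // => i _.
by rewrite (_ : _ == _ = false) ?mulr0 //; apply/negbTE; rewrite neq_ltn (leq_trans _ ge).
Qed.

End Def.
End Model.

(** * Recognizing a model *)

Section Present.
Variables (R : realType) (n : lieAlgebra R) (s : lie_shape).
Hypotheses (n2 : two_step n) (nd : nondeg_shape R s).
Variables (e : nat -> n) (zs : seq n).
Hypotheses (zs_size : size zs = size s.2) (zs_free : free zs).
Hypothesis zs_derived : {subset zs <= derivedv n}.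
Hypothesis e_br : forall i j, (i < j < s.1)%N ->
  [< e i, e j >] = \sum_(k < size s.2) str_const R (nth [::] s.2 k) i j *: zs`_k.

Let e_brT i j : (i < s.1)%N -> (j < s.1)%N ->
  [< e i, e j >] = \sum_(k < size s.2) str_const R (nth [::] s.2 k) i j *: zs`_k.
Proof.
move=> li lj; case: (ltngtP i j) => [ij | ji | <-].
- by rewrite e_br ?ij.
- rewrite brC e_br ?ji // -sumrN; apply: eq_bigr => k _.
  by rewrite -scaleNr /str_const opprB.
by rewrite brr big1 // => k _; rewrite /str_const subrr scale0r.
Qed.

Let W := zs ++ vbasis (centerv n :\: <<zs>>).

Let W_basis : basis_of (centerv n) W.
Proof.
have zsZ : (<<zs>> <= centerv n)%VS.
  apply: subv_trans (derived_center n2); exact/span_subvP.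
have -> : centerv n = (<<zs>> + (centerv n :\: <<zs>>))%VS.
  by rewrite addvC addv_diff (addv_idPl zsZ).
apply: cat_basis; last exact: vbasisP.
  by apply/directv_addP; rewrite capvC capv_diff.
by rewrite /basis_of eqxx.
Qed.

Let p : nat := \dim (centerv n).

Let W_size : size W = p.
Proof. by rewrite /p -(span_basis W_basis); have /eqP := basis_free W_basis. Qed.

Let f (u : model R s p) : n :=
  \sum_(i < s.1) u.1 0 i *: e i + \sum_(k < p) u.2 0 k *: W`_k.

Let f_linear : linear f.
Proof.
move=> c u v; rewrite /f [in RHS]scalerDr !scaler_sumr addrACA -!big_split /=.
by congr (_ + _); apply: eq_bigr => k _; rewrite !mxE scalerDl scalerA.
Qed.

Let f_central (u : 'rV[R]_p) : \sum_(k < p) u 0 k *: W`_k \in centerv n.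
Proof.
apply: memv_suml => k _; apply: memvZ; apply: (basis_mem W_basis).
by apply: mem_nth; rewrite W_size.
Qed.

Let f_br (u v : model R s p) : f [< u, v >] = [< f u, f v >].
Proof.
rewrite {2 3}/f !brE !(center_brl _ (f_central _)) ?addr0.
rewrite (center_brr _ (f_central _)) addr0 ?addr0.
rewrite br_suml /f /= big1 ?add0r => [|i _]; last by rewrite mxE scale0r.
have sp : (size s.2 <= p)%N.
  by rewrite -zs_size -W_size /W size_cat leq_addr.
rewrite (eq_bigr (fun k : 'I_p => sform (nth [::] s.2 k) u.1 v.1 *: W`_k)); last first.
  by move=> k _; rewrite !mxE.
rewrite -(big_mkord xpredT (fun k => sform (nth [::] s.2 k) u.1 v.1 *: W`_k)).
rewrite (big_cat_nat (leq0n _) sp) /= [X in _ + X]big1_seq ?addr0; last first.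
  move=> k /andP[_]; rewrite mem_index_iota => /andP[ge _].
  by rewrite nth_default // /sform big_nil scale0r.
rewrite big_mkord.
under [RHS]eq_bigr => i _.
  rewrite brE br_sumr scaler_sumr.
  under eq_bigr => j _ do rewrite brE e_brT // !scaler_sumr.
  rewrite exchange_big /=; over.
rewrite exchange_big /=; apply: eq_bigr => k _.
rewrite sform_str_const scaler_suml; apply: eq_bigr => i _.
rewrite scaler_suml; apply: eq_bigr => j _.
by rewrite !scalerA nth_cat zs_size ltn_ord.
Qed.

Let f_inj (u : model R s p) : f u = 0 -> u = 0.
Proof.
case: u => x t fu0.
have x0 : x = 0.
  apply: nd => k y lt.
  have sp : (k < p)%N.
    by apply: (leq_trans lt); rewrite -zs_size -W_size /W size_cat leq_addr.
  have := f_br (x, t) ((y, 0) : model R s p).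
  rewrite fu0 br0l /f /= big1 ?add0r => [|i _]; last by rewrite mxE scale0r.
  have Wf := basis_free W_basis; move: (Wf).
  have -> : W = tcast W_size (in_tuple W) by rewrite val_tcast.
  move/freeP => H /H/(_ (Ordinal sp)); by rewrite mxE.
move: fu0; rewrite /f x0 /= big1 ?add0r => [|i _]; last by rewrite mxE scale0r.
have Wf := basis_free W_basis; move: (Wf).
have -> : W = tcast W_size (in_tuple W) by rewrite val_tcast.
move/freeP => H /H t0; congr pair; apply/rowP => k; by rewrite mxE t0.
Qed.

(** The brackets of the e_i and the nondegeneracy of the shape already force
    the e_i to be independent modulo the center, so that they generate n
    together with the center as soon as there are enough of them. *)
Lemma model_present : corank n = s.1 -> lie_iso n (model R s (\dim (centerv n))).
Proof.
move=> cE; apply: lie_iso_sym.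
pose L := GRing.isLinear.Build R (model R s p) n *:%R f f_linear.
pose f' : {linear model R s p -> n} := HB.pack f L.
apply: (@lie_iso_inj _ _ _ f').
- apply: raddf_inj => u; exact: f_inj.
- by rewrite model_dim -cE corankE.
- exact: f_br.
Qed.

End Present.

Section Shapes.
Variable R : realType.

(** [sh_h3] and [sh_h5] give the Heisenberg algebras, [sh_f3] the free two-step
    nilpotent algebra on three generators and [sh_q3] its quotient by a line.
    The last three are the scalar extensions of the Heisenberg algebra h_3 to the
    real algebras of dimension 2, which are R x R for [sh_h3h3], the dual numbers
    for [sh_jet] and C for [sh_h3C]. *)
Definition sh_h3 : lie_shape := (2, [:: [:: (0, 1)]])%N.
Definition sh_q3 : lie_shape := (3, [:: [:: (0, 1)]; [:: (0, 2)]])%N.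
Definition sh_f3 : lie_shape := (3, [:: [:: (0, 1)]; [:: (0, 2)]; [:: (1, 2)]])%N.
Definition sh_h5 : lie_shape := (4, [:: [:: (0, 1); (2, 3)]])%N.
Definition sh_h3h3 : lie_shape := (4, [:: [:: (0, 1)]; [:: (2, 3)]])%N.
Definition sh_jet : lie_shape := (4, [:: [:: (0, 1)]; [:: (0, 2); (1, 3)]])%N.
Definition sh_h3C : lie_shape := (4, [:: [:: (0, 2); (3, 1)]; [:: (1, 2); (0, 3)]])%N.

Definition shapes : seq lie_shape :=
  [:: sh_h3; sh_q3; sh_f3; sh_h5; sh_h3h3; sh_jet; sh_h3C].

Definition rvec q (l : seq R) : 'rV[R]_q := \row_i l`_i.

Lemma co_rvec q l a : (a < q)%N -> co (rvec q l) a = l`_a.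
Proof. exact: (co_row (fun i => l`_i)). Qed.

Tactic Notation "co_crush" hyp(H) constr(k) uconstr(l) :=
  have := H k (rvec _ l) isT; rewrite /sform ?big_cons ?big_nil /= ?co_rvec //=.

Lemma shapes_nondeg s : s \in shapes -> nondeg_shape R s.
Proof.
rewrite !inE => /or4P[||| /or4P[]] /eqP -> /= x H; apply: co_inj => a; rewrite co0 /=.
- co_crush H 0%N [:: 1]; co_crush H 0%N [:: 0; 1].
  by move=> ? ?; case: a => [|[|]] // _; lra.
- co_crush H 0%N [:: 1]; co_crush H 0%N [:: 0; 1]; co_crush H 1%N [:: 1].
  by move=> ? ? ?; case: a => [|[|[|]]] // _; lra.
- co_crush H 0%N [:: 1]; co_crush H 0%N [:: 0; 1]; co_crush H 1%N [:: 1].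
  by move=> ? ? ?; case: a => [|[|[|]]] // _; lra.
- co_crush H 0%N [:: 1]; co_crush H 0%N [:: 0; 1].
  co_crush H 0%N [:: 0; 0; 1]; co_crush H 0%N [:: 0; 0; 0; 1].
  by move=> ? ? ? ?; case: a => [|[|[|[|]]]] // _; lra.
- co_crush H 0%N [:: 1]; co_crush H 0%N [:: 0; 1].
  co_crush H 1%N [:: 0; 0; 1]; co_crush H 1%N [:: 0; 0; 0; 1].
  by move=> ? ? ? ?; case: a => [|[|[|[|]]]] // _; lra.
- co_crush H 0%N [:: 1]; co_crush H 0%N [:: 0; 1].
  co_crush H 1%N [:: 1]; co_crush H 1%N [:: 0; 1].
  by move=> ? ? ? ?; case: a => [|[|[|[|]]]] // _; lra.
- co_crush H 0%N [:: 1]; co_crush H 0%N [:: 0; 1].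
  co_crush H 0%N [:: 0; 0; 1]; co_crush H 0%N [:: 0; 0; 0; 1].
  by move=> ? ? ? ?; case: a => [|[|[|[|]]]] // _; lra.
Qed.

Lemma model_two_step s p : s \in shapes -> (size s.2 <= p)%N -> two_step (model R s p).
Proof.
move=> sS sp; split; last by move=> u v w; rewrite brC /= model_br_center oppr0.
move=> ab; have : (0 < s.1)%N by move: sS; rewrite !inE => /or4P[||| /or4P[]] /eqP ->.
have nd := shapes_nondeg sS; have cZ := model_dim_center nd sp.
have : centerv (model R s p) = fullv.
  by apply/vspaceP => u; rewrite memvf; apply/centerP => v; apply: ab.
move=> E; move: cZ; rewrite E -/(lie_dim _) model_dim => /eqP.
by rewrite -[X in _ == X]add0n eqn_add2r => /eqP ->.
Qed.

Lemma sum_ab_model s p k : (size s.2 <= p)%N ->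
  lie_iso (lie_sum (lie_ab R k) (model R s p)) (model R s (p + k)).
Proof.
move=> sp; pose f (u : lie_sum (lie_ab R k) (model R s p)) : model R s (p + k) :=
  (u.2.1, row_mx u.2.2 u.1).
have fl : linear f.
  by move=> c u v; congr pair; rewrite //= scale_row_mx add_row_mx.
pose L := GRing.isLinear.Build R _ (model R s (p + k)) *:%R f fl.
pose f' : {linear lie_sum (lie_ab R k) (model R s p) -> model R s (p + k)} := HB.pack f L.
exists f'.
  exists (fun v => (rsubmx v.2, (v.1, lsubmx v.2))) => [[a [x t]]|[x t]] /=.
    by rewrite /f /= row_mxKl row_mxKr.
  by rewrite /f /= hsubmxK.
move=> u v; rewrite /= /f /= /sum_br /= /model_br /=; congr pair.
apply/rowP => i; rewrite !mxE; case: split_ordP => j -> /=; rewrite !mxE //.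
by rewrite nth_default ?(leq_trans sp) ?leq_addr // /sform big_nil.
Qed.


End Shapes.

Ltac unroll := rewrite /= !big_ord_recl ?big_ord0 /= /bump /= ?add1n ?addr0.

Lemma mem_eqv (R : realType) (V : vectType R) (U : {vspace V}) (u v : V) :
  u = v -> v \in U -> u \in U.
Proof. by move=> ->. Qed.

(** Evaluates the bracket relations required by [model_present]. *)
Ltac check_brackets := move=> [|[|[|[|?]]]] [|[|[|[|?]]]] /andP[] //= _ _;
  rewrite !big_ord_recl ?big_ord0 /str_const /= ?subr0 ?sub0r ?subrr
    ?scale0r ?scale1r ?scaleN1r ?add0r ?addr0.

(** * Classification in corank at most 4 *)

Section Classification.
Variables (R : realType) (n : lieAlgebra R).
Implicit Types x y z : n.

Lemma indep2P x y : indep_mod_center [:: x; y] <->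
  (forall a b, a *: x + b *: y \in centerv n -> a = 0 /\ b = 0).
Proof.
split=> [H a b K | H a].
  have := H (fun i => [:: a; b]`_i); unroll => /(_ K) E.
  by split; [exact: (E 0%N) | exact: (E 1%N)].
unroll => /H[a0 b0]; by case=> [|[]].
Qed.

Lemma indep3P x y z : indep_mod_center [:: x; y; z] <->
  (forall a b c, a *: x + (b *: y + c *: z) \in centerv n -> [/\ a = 0, b = 0 & c = 0]).
Proof.
split=> [H a b c K | H a].
  have := H (fun i => [:: a; b; c]`_i); unroll => /(_ K) E.
  by split; [exact: (E 0%N) | exact: (E 1%N) | exact: (E 2%N)].
unroll => /H[a0 b0 c0]; by case=> [|[|[]]].
Qed.

Lemma indep4P x y z w : indep_mod_center [:: x; y; z; w] <->
  (forall a b c d, a *: x + (b *: y + (c *: z + d *: w)) \in centerv n ->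
     [/\ a = 0, b = 0, c = 0 & d = 0]).
Proof.
split=> [H a b c d K | H a].
  have := H (fun i => [:: a; b; c; d]`_i); unroll => /(_ K) E.
  by split; [exact: (E 0%N) | exact: (E 1%N) | exact: (E 2%N) | exact: (E 3%N)].
unroll => /H[a0 b0 c0 d0]; by case=> [|[|[|[]]]].
Qed.

Lemma indep6 x y z w u v :
  (forall a b c d e f,
     a *: x + (b *: y + (c *: z + (d *: w + (e *: u + f *: v)))) \in centerv n ->
     [/\ a = 0, b = 0, c = 0 & d = 0] /\ e = 0 /\ f = 0) ->
  indep_mod_center [:: x; y; z; w; u; v].
Proof.
move=> H a; unroll => /H[[a0 b0 c0 d0] [e0 f0]].
by case=> [|[|[|[|[|[]]]]]].
Qed.

Lemma free2P x y : (forall a b, a *: x + b *: y = 0 -> a = 0 /\ b = 0) ->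
  free [:: x; y].
Proof. move=> H; apply: free_coef => a; unroll => /H[? ?]; by case=> [|[]]. Qed.

Lemma free3P x y z :
  (forall a b c, a *: x + (b *: y + c *: z) = 0 -> [/\ a = 0, b = 0 & c = 0]) ->
  free [:: x; y; z].
Proof. move=> H; apply: free_coef => a; unroll => /H[? ? ?]; by case=> [|[|[]]]. Qed.

Lemma free2_coef x y : free [:: x; y] ->
  forall a b, a *: x + b *: y = 0 -> a = 0 /\ b = 0.
Proof.
move=> /(@freeP _ _ _ (in_tuple [:: x; y])) H a b E.
have := H (fun i => [:: a; b]`_i); unroll => /(_ E) K.
by split; [exact: (K ord0) | exact: (K (lift ord0 ord0))].
Qed.

Lemma free2 x y : x != 0 -> y \notin <[x]>%VS -> free [:: x; y].
Proof.
move=> x0 yx; rewrite (@perm_free _ _ _ [:: y; x]) ?(perm_catC [:: x]) //.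
by rewrite free_cons span_seq1 yx seq1_free.
Qed.

Lemma span2P x y v : v \in <<[:: x; y]>>%VS -> exists a b, v = a *: x + b *: y.
Proof. by case/mem_span_coef => a; unroll => ->; exists (a 0%N), (a 1%N). Qed.

Lemma free_leq_dim (X : seq n) (U : {vspace n}) : free X ->
  {subset X <= U} -> (size X <= \dim U)%N.
Proof. by move=> /eqP <- H; apply/dimvS/span_subvP. Qed.

Lemma derived2 x y : free [:: x; y] -> x \in derivedv n -> y \in derivedv n ->
  (\dim (derivedv n) <= 2)%N ->
  forall u v : n, exists a b, [< u, v >] = a *: x + b *: y.
Proof.
move=> fX xD yD d2 u v; apply: span2P.
suff -> : <<[:: x; y]>>%VS = derivedv n by apply: br_derived.
apply/eqP; rewrite eqEdim; move: (fX) => /eqP ->; rewrite d2 andbT.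
by apply/span_subvP => z; rewrite !inE => /orP[] /eqP ->.
Qed.

Hypothesis n2 : two_step n.

(** That is, ad x has rank at most one. *)
Definition rank_le1 x : Prop := exists z, forall y, [< x, y >] \in <[z]>%VS.

Definition dim1_derived : Prop := exists z, forall x y, [< x, y >] \in <[z]>%VS.
Definition has_noncentral_rank1 : Prop :=
  exists2 x, x \notin centerv n & rank_le1 x.
Definition has_noncommuting_rank1 : Prop :=
  exists x y, [/\ rank_le1 x, rank_le1 y & [< x, y >] <> 0 :> n].

Lemma line_eq z z' u : u != 0 -> u \in <[z]>%VS -> z' \in <[z]>%VS ->
  z' \in <[u]>%VS.
Proof.
move=> u0 /vlineP[a ua] /vlineP[b ->].
have a0 : a != 0 by apply: contraNneq u0 => a0; rewrite ua a0 scale0r.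
by apply/vlineP; exists (b / a); rewrite ua scalerA divfK.
Qed.

Lemma rank_le1_line x y : [< x, y >] <> 0 :> n -> rank_le1 x ->
  forall w, [< x, w >] \in <[ [< x, y >] ]>%VS.
Proof. by move=> /eqP xy [z H] w; apply: line_eq (H y) (H w). Qed.

Lemma classify_corank2 : corank n = 2 -> lie_iso n (model R sh_h3 (\dim (centerv n))).
Proof.
move=> q2; have [x [y xy]] := two_step_br n2.
apply: (@model_present _ _ sh_h3 n2 _ (fun i => [:: x; y]`_i) [:: [< x, y >]]) => //.
- exact: shapes_nondeg.
- by rewrite seq1_free; apply/eqP.
- by move=> z; rewrite inE => /eqP ->; apply: br_derived.
- by check_brackets.
Qed.

(** If the three brackets of a basis modulo the center are dependent, then two
    independent elements u and v commute, because every bivector in dimension 3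
    is decomposable. *)
Lemma classify_corank3 : corank n = 3 ->
  lie_iso n (model R sh_q3 (\dim (centerv n))) /\ (2 <= \dim (derivedv n))%N \/
  lie_iso n (model R sh_f3 (\dim (centerv n))) /\ (3 <= \dim (derivedv n))%N.
Proof.
move=> q3; have [X iX sX] := exists_complement n.
move: X iX sX; rewrite q3 => -[|e1 [|e2 [|e3 [|]]]] // iX _.
have [H|/existsNP[a /existsNP[b /existsNP[c /not_implyP[E N]]]]] := pselect
  (forall a b c, a *: [< e1, e2 >] + (b *: [< e1, e3 >] + c *: [< e2, e3 >]) = 0
    -> [/\ a = 0, b = 0 & c = 0]).
  right; have fX := free3P H; split.
    apply: (@model_present _ _ sh_f3 n2 _ (fun i => [:: e1; e2; e3]`_i)) fX _ _ _ => //.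
    - exact: shapes_nondeg.
    - by move=> z; rewrite !inE => /or3P[] /eqP ->; apply: br_derived.
    - by check_brackets.
  apply: (free_leq_dim fX).
  by move=> z; rewrite !inE => /or3P[] /eqP ->; apply: br_derived.
left; move/indep3P: iX => iX.
have [u [v [iuv uv]]] : exists u v, indep_mod_center [:: u; v] /\ [< u, v >] = 0 :> n.
  have [a0|a0] := eqVneq a 0.
    (* the relation says that the bivector u ^ v has bracket 0 *)
    exists (b *: e1 + c *: e2), e3; split; last first.
      by rewrite !brE -E a0 scale0r add0r.
    apply/indep2P => s t H.
    have [|sb sc ->] := iX (s * b) (s * c) t.
      by move: H; rewrite scalerDr !scalerA addrA.
    split=> //; apply: contrapT => /eqP s0; apply: N; split=> //.
      by apply: (mulfI s0); rewrite mulr0.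
    by apply: (mulfI s0); rewrite mulr0.
  exists (a *: e1 - c *: e3), (a *: e2 + b *: e3); split; last first.
    rewrite !brE (brC e3 e2) -[RHS](scaler0 _ a) -[in RHS]E.
    by vring.
  apply/indep2P => s t H.
  have [|/eqP sa /eqP ta _] := iX (s * a) (t * a) (t * b - s * c).
    by apply: mem_eqv H; vring.
  move: sa ta; rewrite !mulf_eq0 (negbTE a0) !orbF => /eqP -> /eqP ->; by [].
have [|w iw] := indep_extend iuv; first by rewrite q3.
have vu : [< v, u >] = 0 :> n by rewrite brC uv oppr0.
have fX : free [:: [< w, u >]; [< w, v >]].
  apply: free2P => s t H; move/indep2P: iuv; apply.
  apply: (centralP_gen iw); first by rewrite q3.
  move=> e; rewrite !inE => /or3P[] /eqP ->; rewrite brC !brE ?H ?uv ?vu;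
    by rewrite ?scaler0 ?addr0 ?oppr0.
split.
  apply: (@model_present _ _ sh_q3 n2 _ (fun i => [:: w; u; v]`_i)) fX _ _ _ => //.
  - exact: shapes_nondeg.
  - by move=> z; rewrite !inE => /orP[] /eqP ->; apply: br_derived.
  - by check_brackets.
apply: (free_leq_dim fX).
by move=> z; rewrite !inE => /orP[] /eqP ->; apply: br_derived.
Qed.

End Classification.

Section Corank4.
Variables (R : realType) (n : lieAlgebra R).
Hypotheses (n2 : two_step n) (q4 : corank n = 4).
Implicit Types x y z : n.

Lemma commute_sym x y : [< x, y >] = 0 :> n -> [< y, x >] = 0 :> n.
Proof. by move=> e; rewrite brC e oppr0. Qed.

Lemma commute_correction x y s :
  [< x, s >] \in <[ [< x, y >] ]>%VS -> [< y, s >] \in <[ [< x, y >] ]>%VS ->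
  exists a b, let s' := s + (a *: x + b *: y) in
    [< x, s' >] = 0 :> n /\ [< y, s' >] = 0 :> n.
Proof.
move=> /vlineP[a xs] /vlineP[b ys]; exists b, (- a) => /=.
by split; rewrite !brE ?(brC y x) ?xs ?ys; vring.
Qed.

(** The bracket is a symplectic form on the quotient by the center, and the proof
    builds a symplectic basis. *)
Lemma classify_h5 : dim1_derived n ->
  lie_iso n (model R sh_h5 (\dim (centerv n))).
Proof.
case=> z0 Dz0; have [x [y xy]] := two_step_br n2; set z := [< x, y >] in xy.
have Dz s t : [< s, t >] \in <[z]>%VS.
  by apply: line_eq (Dz0 x y) (Dz0 s t); apply/eqP.
have z0' : z != 0 by apply/eqP.
have [|u [uZ xu yu]] := common_centralizer (Dz x) (Dz y).
  by rewrite q4 !dim_vline z0'.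
have [w uw] := notin_centerP uZ.
have /vlineP[c uwz] := Dz u w.
have c0 : c != 0 by apply/eqP => c0; apply: uw; rewrite uwz c0 scale0r.
have [a [b [xw yw]]] := commute_correction (Dz x (c^-1 *: w)) (Dz y (c^-1 *: w)).
move: xw yw; set w' := _ + _ => xw yw.
have uw' : [< u, w' >] = z.
  by rewrite /w' !brE (commute_sym xu) (commute_sym yu) uwz; vfield.
apply: (@model_present _ _ sh_h5 n2 _ (fun i => [:: x; y; u; w']`_i) [:: z]) => //.
- exact: shapes_nondeg.
- by rewrite seq1_free.
- by move=> t; rewrite inE => /eqP ->; apply: br_derived.
- by check_brackets.
Qed.

(** A noncommuting pair of rank one elements and its bracket z span a Heisenberg
    algebra. Two elements whose bracket is not on the line of z can be corrected
    to commute with the pair, and then span a second Heisenberg algebra. *)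
Lemma classify_h3h3 : ~ dim1_derived n -> has_noncommuting_rank1 n ->
  lie_iso n (model R sh_h3h3 (\dim (centerv n))) /\ (2 <= \dim (derivedv n))%N.
Proof.
move=> nD1 [x [y [rx ry xy]]]; set z := [< x, y >] in xy.
have z0 : z != 0 by apply/eqP.
have xz w : [< x, w >] \in <[z]>%VS by apply: rank_le1_line.
have yz w : [< y, w >] \in <[z]>%VS.
  have yx : [< y, x >] <> 0 :> n by rewrite brC => /eqP; rewrite oppr_eq0 => /eqP.
  have : [< y, w >] \in <[ [< y, x >] ]>%VS by apply: rank_le1_line.
  rewrite (brC y x) => /vlineP[k ->]; apply/vlineP; exists (- k).
  by rewrite scalerN scaleNr.
have [s [t st]] : exists s t, [< s, t >] \notin <[z]>%VS.
  apply: contrapT => H; apply: nD1; exists z => s t.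
  by apply/negPn/negP => K; apply: H; exists s, t.
have [a [b []]] := commute_correction (xz s) (yz s); set s' := s + _ => xs ys.
have [c [d []]] := commute_correction (xz t) (yz t); set t' := t + _ => xt yt.
have st' : [< s', t' >] \notin <[z]>%VS.
  have -> : [< s', t' >] = [< s, t' >].
    by rewrite {1}/s' !(brDl, brZl) xt yt !scaler0 !addr0.
  rewrite /t' 2!brDr rpredDr // !brE rpredD // memvZ // brC memvN //.
have fX : free [:: z; [< s', t' >]] by apply: free2.
split.
  apply: (@model_present _ _ sh_h3h3 n2 _ (fun i => [:: x; y; s'; t']`_i)) fX _ _ _ => //.
  - exact: shapes_nondeg.
  - by move=> w; rewrite !inE => /orP[] /eqP ->; apply: br_derived.
  - by check_brackets.
apply: (free_leq_dim fX).
by move=> w; rewrite !inE => /orP[] /eqP ->; apply: br_derived.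
Qed.

Hypothesis d2 : (\dim (derivedv n) <= 2)%N.

(** With x of rank one and [y, x] = z2, choose u and v commuting with x such that
    [y, u] = z1 and [y, v] = 0. If [u, v] were not a multiple of z2, then v and
    u + (b / a) x would be noncommuting elements of rank one. *)
Lemma classify_jet : has_noncentral_rank1 n -> ~ has_noncommuting_rank1 n ->
  lie_iso n (model R sh_jet (\dim (centerv n))) /\ (2 <= \dim (derivedv n))%N.
Proof.
move=> [x xZ rx] nE2.
have [y xy] := notin_centerP xZ.
have nry : ~ rank_le1 y by move=> ry; apply: nE2; exists x, y.
set z2 := [< y, x >].
have xyE : [< x, y >] = - z2 by rewrite brC.
have z20 : z2 != 0 by rewrite -oppr_eq0 -xyE; apply/eqP.
have xz w : [< x, w >] \in <[z2]>%VS.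
  have /vlineP[k ->] := rank_le1_line xy rx w.
  by rewrite xyE; apply/memvZ; rewrite memvN memv_line.
have [u0 yu0] : exists u0, [< y, u0 >] \notin <[z2]>%VS.
  apply: contrapT => H; apply: nry; exists z2 => w.
  by apply/negPn/negP => K; apply: H; exists w.
have /vlineP[c xu0] := xz u0.
set z1 := [< y, u0 >] in yu0.
have [u xu yu] : exists2 u, [< x, u >] = 0 :> n & [< y, u >] = z1.
  exists (u0 + c *: y); rewrite !brE ?xu0 ?xyE; vring.
have fX : free [:: z1; z2].
  by rewrite free_cons span_seq1 yu0 seq1_free.
have z1D : z1 \in derivedv n by apply: br_derived.
have z2D : z2 \in derivedv n by apply: br_derived.
have Dz := derived2 fX z1D z2D d2.
have [|v [vZ xv yv]] := common_centralizer xz (br_derived y).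
  by rewrite q4 dim_vline z20; lia.
have iX : indep_mod_center [:: y; u; x; v].
  apply/indep4P => a b g d H.
  have /centerP/(_ x) := H; have /centerP/(_ y) := H.
  rewrite !brE (brC u y) yu xyE (brC v y) yv (brC u x) xu (brC v x) xv.
  rewrite !oppr0 !scaler0 !addr0 !add0r => E1 E2.
  have a0 : a = 0.
    by move/eqP: E2; rewrite scaler_eq0 (negbTE z20) orbF => /eqP.
  have [|b0 g0] := free2_coef fX (a := - b) (b := - g).
    by rewrite -E1; vring.
  have {}b0 : b = 0 by lra.
  have {}g0 : g = 0 by lra.
  split=> //; move: H; rewrite a0 b0 g0 !scale0r !add0r => H.
  by apply: contraNeq vZ => d0; rewrite -[v](scalerK d0) memvZ.
have uv : [< u, v >] <> 0.
  move=> uv; move/negP: vZ; apply; apply: (centralP_gen iX); first by rewrite q4.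
  by move=> e; rewrite !inE => /or4P[] /eqP ->; rewrite ?brr // brC ?uv ?xv ?yv oppr0.
have [a [b uvE]] := Dz u v.
have a0 : a = 0.
  apply/eqP; apply: contrapT => /negP a0; apply: nE2.
  exists v, (u + (b / a) *: x); split.
  - exists [< u, v >]; apply: (br_mem_gen iX); first by rewrite q4.
    move=> e; rewrite !inE => /or4P[] /eqP ->; rewrite ?brr ?mem0v //.
    + by rewrite brC yv oppr0 mem0v.
    + by rewrite brC memvN memv_line.
    + by rewrite brC xv oppr0 mem0v.
  - exists [< u, v >]; apply: (br_mem_gen iX); first by rewrite q4.
    move=> e; rewrite !inE => /or4P[] /eqP ->; rewrite !brE ?xu ?xv ?xyE.
    + rewrite (brC u y) yu; apply/vlineP; exists (- a^-1).
      by rewrite uvE; vfield.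
    + by rewrite scaler0 addr0 mem0v.
    + by rewrite brC xu oppr0 scaler0 addr0 mem0v.
    + by rewrite scaler0 addr0 memv_line.
  - by rewrite !brE (brC v u) (brC v x) xv oppr0 scaler0 addr0; apply: contra_not uv => /eqP; rewrite oppr_eq0 => /eqP.
have b0 : b != 0 by apply/eqP => b0; apply: uv; rewrite uvE a0 b0 !scale0r addr0.
have uv' : [< u, b^-1 *: v >] = z2 by rewrite brZr uvE a0; vfield.
split.
  apply: (@model_present _ _ sh_jet n2 _ (fun i => [:: y; u; x; b^-1 *: v]`_i)) fX _ _ _ => //.
  - exact: shapes_nondeg.
  - by move=> w; rewrite !inE => /orP[] /eqP ->.
  - check_brackets; rewrite ?uv' ?brZr ?xv ?yv ?scaler0 //.
    by rewrite brC xu oppr0.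
apply: (free_leq_dim fX).
by move=> w; rewrite !inE => /orP[] /eqP ->.
Qed.

(** If f is a noncentral element that commutes with e1, not a multiple of e1 modulo
    the center, then ad f (ad e1)^-1 is an endomorphism of the derived plane. It
    has no real eigenvalue l, since f - l e1 would have rank one; so an affine
    change of f makes it a complex structure. *)
Lemma classify_h3C : ~ has_noncentral_rank1 n ->
  lie_iso n (model R sh_h3C (\dim (centerv n))) /\ (2 <= \dim (derivedv n))%N.
Proof.
move=> nE1.
have nrank1 x z : x \notin centerv n -> ~ (forall y, [< x, y >] \in <[z]>%VS).
  by move=> xZ H; apply: nE1; exists x => //; exists z.
have [e1 [e3 e13]] := two_step_br n2; set z1 := [< e1, e3 >] in e13.
have z10 : z1 != 0 by apply/eqP.
have e1Z : e1 \notin centerv n.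
  by apply/negP => /centerP H; apply: e13; rewrite /z1 H.
have [f e1f if1] : exists2 f, [< e1, f >] = 0 :> n & indep_mod_center [:: f; e1].
  have : ~~ (lker (ad e1) <= <<[:: e1]>> + centerv n)%VS.
    apply/negP => /dimvS; rewrite (indep_dim (indep_seq1 e1Z)).
    have := dim_ker_ad (br_derived e1); have := corankE n; rewrite q4 /=; lia.
  case/subvPn => f; rewrite memv_ker adE => /eqP ? ?; exists f => //.
  by apply: indep_cons => //; apply: indep_seq1.
have /indep2P if1' := if1.
have fe1 : [< f, e1 >] = 0 by rewrite brC e1f oppr0.
have iX3 : indep_mod_center [:: e3; f; e1].
  apply/indep3P => a b c H; have /centerP/(_ e1) := H.
  rewrite !brE fe1 (brC e3) !scaler0 !addr0 => /eqP.
  rewrite scalerN oppr_eq0 scaler_eq0 (negbTE z10) orbF => /eqP a0.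
  by move: H; rewrite a0 scale0r add0r => /if1'[].
have gZ c : f + c *: e1 \notin centerv n.
  apply/negP => H; have [|] := if1' 1 c; first by rewrite scale1r.
  by move/eqP; rewrite oner_eq0.
set w := [< f, e3 >].
have wz1 : w \notin <[z1]>%VS.
  apply/vlineP => -[l wE]; have [|e4 iX] := indep_extend iX3; first by rewrite q4.
  apply: (nrank1 (f + (- l) *: e1) [< f + (- l) *: e1, e4 >] (gZ _)).
  apply: (br_mem_gen iX); first by rewrite q4.
  move=> e; rewrite !inE => /or4P[] /eqP ->; rewrite ?memv_line //.
  - rewrite (_ : [< _, _ >] = 0) ?mem0v // !brE -/w wE -/z1; vring.
  - by rewrite !brE e1f !scaler0 addr0 mem0v.
  - by rewrite !brE fe1 !scaler0 addr0 mem0v.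
have fX : free [:: z1; w] by apply: free2.
have z1D : z1 \in derivedv n by apply: br_derived.
have wD : w \in derivedv n by apply: br_derived.
have Dz := derived2 fX z1D wD d2.
have [e4 e14] : exists e4, [< e1, e4 >] = w.
  have [t et] : exists t, [< e1, t >] \notin <[z1]>%VS.
    apply: contrapT => H; apply: (nrank1 e1 z1 e1Z) => t.
    by apply/negPn/negP => K; apply: H; exists t.
  have [a [b E]] := Dz e1 t.
  have b0 : b != 0.
    by apply: contraNneq et => b0; rewrite E b0 scale0r addr0 memvZ // memv_line.
  by exists (b^-1 *: (t - a *: e3)); rewrite !brE E -/z1; vfield.
have [a [b fe4]] := Dz f e4.
have iX : indep_mod_center [:: e4; e3; f; e1].
  apply/indep4P => k1 k2 k3 k4 H; have /centerP/(_ e1) := H.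
  rewrite !brE fe1 (brC e3) (brC e4) e14 -/z1 !scaler0 !addr0 => E.
  have [|k20 k10] := free2_coef fX (a := - k2) (b := - k1).
    by rewrite -E; vring.
  have {}k10 : k1 = 0 by lra.
  have {}k20 : k2 = 0 by lra.
  by move: H; rewrite k10 k20 !scale0r !add0r => /if1'[].
(* the characteristic polynomial of this endomorphism is l^2 - b l - a *)
have disc : b ^+ 2 + 4 * a < 0.
  rewrite ltNge; apply/negP => d0.
  pose l := (b + Num.sqrt (b ^+ 2 + 4 * a)) / 2.
  have lE : l * (b - l) = - a.
    have := sqr_sqrtr d0; rewrite /l; set r := Num.sqrt _ => rE.
    have -> : a = (r ^+ 2 - b ^+ 2) / 4 by rewrite rE; field.
    by field.
  apply: (nrank1 (f + (- l) *: e1) (w - l *: z1) (gZ _)).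
  apply: (br_mem_gen iX); first by rewrite q4.
  move=> e; rewrite !inE => /or4P[] /eqP ->; rewrite !brE.
  - apply/vlineP; exists (b - l); rewrite fe4 e14.
    have -> : a = - (l * (b - l)) by rewrite lE opprK.
    by vring.
  - by apply/vlineP; exists 1; rewrite -/w -/z1; vring.
  - by rewrite e1f !scaler0 addr0 mem0v.
  - by rewrite fe1 !scaler0 addr0 mem0v.
(* nu is the imaginary part of the eigenvalues, and b / 2 their real part *)
pose nu := Num.sqrt (- (a + b ^+ 2 / 4)).
have nu2 : nu ^+ 2 = - (a + b ^+ 2 / 4) by rewrite sqr_sqrtr //; lra.
have nu0 : nu != 0 by rewrite gt_eqF // sqrtr_gt0; lra.
have aE : a = - nu ^+ 2 - b ^+ 2 / 4 by rewrite nu2; ring.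
pose z2 := nu^-1 *: (w - (b / 2) *: z1).
have z2D : z2 \in derivedv n by rewrite memvZ // memvB // memvZ.
have fX2 : free [:: z1; z2].
  apply: free2 => //; apply: contra wz1 => /(memvZ nu).
  rewrite scalerA divff // scale1r => H.
  by rewrite -[w](subrK ((b / 2) *: z1)) memvD // memvZ // memv_line.
have Dz2 := derived2 fX2 z1D z2D d2.
have [f' [e4' [e1f' f'e3 e1e4 f'e4]]] : exists f' e4', [/\ [< e1, f' >] = 0 :> n,
    [< f', e3 >] = z2, [< e1, e4' >] = z2 & [< f', e4' >] = - z1].
  exists (nu^-1 *: (f - (b / 2) *: e1)), (nu^-1 *: (e4 - (b / 2) *: e3)).
  split; rewrite !brE ?e1f ?e14 ?fe4 -/w -/z1 ?aE.
  - by vring.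
  - by rewrite /z2; vring.
  - by rewrite /z2; vring.
  - by vfield.
(* adding multiples of e1 to e3 and e4' makes them commute *)
have [k1 [k2 e34]] := Dz2 e3 e4'.
have f'e1 : [< f', e1 >] = 0 by rewrite brC e1f' oppr0.
split.
  apply: (@model_present _ _ sh_h3C n2 _
    (fun i => [:: e1; f'; e3 - k2 *: e1; e4' + k1 *: e1]`_i)) fX2 _ _ _ => //.
  - exact: shapes_nondeg.
  - by move=> v; rewrite !inE => /orP[] /eqP ->.
  - check_brackets; rewrite ?brE //.
    + by rewrite -/z1; vring.
    + by rewrite e1e4; vring.
    + by rewrite f'e3 f'e1; vring.
    + by rewrite f'e4 f'e1; vring.
    + by rewrite e34 e1e4 (brC e3 e1) -/z1; vring.
apply: (free_leq_dim fX2).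
by move=> v; rewrite !inE => /orP[] /eqP ->.
Qed.


End Corank4.

Lemma odd_skew_kernel (R : realType) k (M : 'M[R]_k) : odd k -> M^T = - M ->
  exists2 a : 'rV[R]_k, a != 0 & a *m M = 0.
Proof.
move=> ok MT; apply/det0P; have := det_tr M.
rewrite MT -scaleN1r detZ -signr_odd ok expr1 mulN1r => e.
by apply/eqP; lra.
Qed.

Section Classify.
Variables (R : realType) (n : lieAlgebra R).
Hypothesis n2 : two_step n.

(** The bracket is then a nondegenerate alternating form on the quotient by the
    center. *)
Lemma dim1_corank_even : dim1_derived n -> ~~ odd (corank n).
Proof.
move=> [z0 D]; apply/negP => oq.
have [x0 [y0 xy0]] := two_step_br n2; set z := [< x0, y0 >] in xy0.
have Dz u v : exists c, [< u, v >] = c *: z.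
  by apply/vlineP; apply: line_eq (D x0 y0) (D u v); apply/eqP.
have [X iX sX] := exists_complement n.
have [c cE] := choice (fun u : n * n => Dz u.1 u.2).
have z_inj b : b *: z = 0 -> b = 0.
  by move/eqP; rewrite scaler_eq0 => /orP[/eqP // | /eqP /xy0].
pose M : 'M[R]_(size X) := \matrix_(i, j) c (X`_i, X`_j).
have [||a /rV0Pn[i0 ai0] aM] := @odd_skew_kernel R _ M; first by rewrite sX.
  apply/matrixP => i j; rewrite !mxE; apply/eqP; rewrite -addr_eq0; apply/eqP.
  by apply: z_inj; rewrite scalerDl -!cE /= brC addNr.
move/eqP: ai0; apply.
have := iX (fun i => co a i); under eq_bigr do rewrite coE.
move=> /(_ _ i0); rewrite coE; apply; last exact: ltn_ord.
apply: (centralP_gen iX sX) => e eX; rewrite br_suml.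
have ltj : (index e X < size X)%N by rewrite index_mem.
transitivity ((a *m M) 0 (Ordinal ltj) *: z); last by rewrite aM mxE scale0r.
rewrite mxE scaler_suml; apply: eq_bigr => i _.
by rewrite brZl mxE -scalerA -cE /= nth_index.
Qed.

Lemma dim1_derivedP : (\dim (derivedv n) <= 1)%N -> dim1_derived n.
Proof.
move=> d1; have [x [y xy]] := two_step_br n2; exists [< x, y >] => u v.
suff -> : <[ [< x, y >] ]>%VS = derivedv n by apply: br_derived.
apply/eqP; rewrite eqEdim -memvE br_derived /=; apply: leq_trans d1 _.
by rewrite dim_vline; move/eqP: xy => ->.
Qed.

(** Two noncommuting elements are independent modulo the center. *)
Lemma corank_ge2 : (2 <= corank n)%N.
Proof.
have [x [y xy]] := two_step_br n2.
apply: (@indep_leq _ _ [:: x; y]); apply/indep2P => a b /centerP H.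
have := H x; have := H y.
rewrite !brE !scaler0 addr0 add0r (brC y) => /eqP; rewrite scaler_eq0.
move/eqP/negbTE: (xy) => -> /[!orbF] /eqP ->.
by move=> /eqP; rewrite scaler_eq0 oppr_eq0; move/eqP/negbTE: xy => -> /[!orbF] /eqP ->.
Qed.

(** In corank 4, the existence of rank one elements, commuting or not, decides
    between the models. A corank greater than 4 could only be 5, with a derived
    algebra of dimension one, and this requires an even corank. *)
Theorem classify : (corank n + \dim (derivedv n) <= 6)%N ->
  exists s, [/\ s \in shapes, lie_iso n (model R s (\dim (centerv n))) &
                 (size s.2 <= \dim (derivedv n))%N].
Proof.
move=> le6; have d0 := derived_neq0 n2; have q2 := corank_ge2.
have : corank n \in iota 2 4 by rewrite mem_iota; lia.
rewrite !inE => /or4P[] /eqP q.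
- by exists sh_h3; split=> //; apply: classify_corank2.
- have [[iso d]|[iso d]] := classify_corank3 n2 q.
    by exists sh_q3.
  by exists sh_f3.
- have d2 : (\dim (derivedv n) <= 2)%N by move: le6; rewrite q; lia.
  have [D1|nD1] := pselect (dim1_derived n).
    by exists sh_h5; split=> //; apply: classify_h5.
  have [E2|nE2] := pselect (has_noncommuting_rank1 n).
    by have [? ?] := classify_h3h3 n2 q nD1 E2; exists sh_h3h3.
  have [E1|nE1] := pselect (has_noncentral_rank1 n).
    by have [? ?] := classify_jet n2 q d2 E1 nE2; exists sh_jet.
  by have [? ?] := classify_h3C n2 q d2 nE1; exists sh_h3C.
have /dim1_derivedP/dim1_corank_even : (\dim (derivedv n) <= 1)%N.
  by move: le6; rewrite q; lia.
by rewrite q.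
Qed.

End Classify.

(** * Invariants separating the models *)

Section Invariants.
Variable R : realType.
Implicit Types n m : lieAlgebra R.

Lemma rank_le1_iso n m (f : {linear n -> m}) : bijective f ->
  (forall x y, f [< x, y >] = [< f x, f y >]) ->
  forall x, rank_le1 x -> rank_le1 (f x).
Proof.
move=> [g fK gK] fbr x [z H]; exists (f z) => y.
have /vlineP[c xc] := H (g y).
by rewrite -(gK y) -fbr xc linearZ /= memvZ // memv_line.
Qed.

Lemma dim1_derived_iso n m : lie_iso n m -> dim1_derived n -> dim1_derived m.
Proof.
case=> f [g fK gK] fbr [z H]; exists (f z) => x y.
have /vlineP[c xc] := H (g x) (g y).
by rewrite -(gK x) -(gK y) -fbr xc linearZ /= memvZ // memv_line.
Qed.

Lemma noncentral_rank1_iso n m :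
  lie_iso n m -> has_noncentral_rank1 n -> has_noncentral_rank1 m.
Proof.
case=> f bf fbr [x xZ rx]; exists (f x); last exact: rank_le1_iso.
apply: contra xZ => /centerP H; apply/centerP => y.
by apply: (bij_inj bf); rewrite fbr H linear0.
Qed.

Lemma noncommuting_rank1_iso n m :
  lie_iso n m -> has_noncommuting_rank1 n -> has_noncommuting_rank1 m.
Proof.
case=> f bf fbr [x [y [rx ry xy]]]; exists (f x), (f y).
split; [exact: rank_le1_iso | exact: rank_le1_iso | move=> H; apply: xy].
by apply: (bij_inj bf); rewrite fbr H linear0.
Qed.

Lemma noncommuting_noncentral n : has_noncommuting_rank1 n -> has_noncentral_rank1 n.
Proof.
case=> x [y [rx _ xy]]; exists x => //; apply/negP => /centerP xZ.
exact/xy/xZ.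
Qed.

Section Model.
Variables (s : lie_shape) (p : nat).
Hypothesis sp : (size s.2 <= p)%N.
Let m := model R s p.

Lemma co_br (u v : m) k : (k < size s.2)%N ->
  co [< u, v >].2 k = sform (nth [::] s.2 k) u.1 v.1.
Proof.
move=> lt; rewrite /= (co_row (fun k => sform (nth [::] s.2 k) u.1 v.1)) //.
exact: leq_trans lt sp.
Qed.

Lemma rank_le1_minor (u : m) : rank_le1 u ->
  forall k l x y, (k < size s.2)%N -> (l < size s.2)%N ->
  let F k (x : 'rV[R]_s.1) := sform (nth [::] s.2 k) u.1 x in F k x * F l y = F l x * F k y.
Proof.
case=> z H k l x y ks ls /=.
have /vlineP[a xa] := H (x, 0); have /vlineP[b yb] := H (y, 0).
rewrite -!(@co_br u (x, 0)) // -!(@co_br u (y, 0)) // xa yb.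
by rewrite /= !coZ; ring.
Qed.

Lemma dim1_derived_minor : dim1_derived m ->
  forall x y x' y' k l, (k < size s.2)%N -> (l < size s.2)%N ->
  let F k (x y : 'rV[R]_s.1) := sform (nth [::] s.2 k) x y in
  F k x y * F l x' y' = F l x y * F k x' y'.
Proof.
case=> z H x y x' y' k l ks ls /=.
have /vlineP[a xa] := H (x, 0) (y, 0); have /vlineP[b yb] := H (x', 0) (y', 0).
rewrite -!(@co_br (x, 0) (y, 0)) // -!(@co_br (x', 0) (y', 0)) // xa yb.
by rewrite /= !coZ; ring.
Qed.

Lemma rank_le1_support (x : 'rV[R]_s.1) (t : 'rV[R]_p) k : (k < p)%N ->
  (forall l y, (l < size s.2)%N -> l != k -> sform (nth [::] s.2 l) x y = 0) ->
  rank_le1 ((x, t) : m).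
Proof.
move=> kp H; exists ((0, delta_mx 0 (Ordinal kp)) : m) => y; apply/vlineP.
exists (sform (nth [::] s.2 k) x y.1); congr pair; first by rewrite scaler0.
apply/rowP => l; rewrite !mxE /=; have [-> | lk] := eqVneq l (Ordinal kp).
  by rewrite mulr1.
rewrite mulr0; have [lt | ge] := ltnP l (size s.2).
  by apply: H.
by rewrite nth_default // /sform big_nil.
Qed.

End Model.
End Invariants.

Section Separate.
Variables (R : realType) (p : nat).

Ltac sform_simp := rewrite /sform ?big_cons ?big_nil /= ?co_rvec //=.

Let unit q a : 'rV[R]_q := rvec q (rcons (nseq a 0) 1).

Let unit_neq0 q a : (a < q)%N -> unit q a != 0.
Proof.
move=> lt; apply/eqP => /(congr1 (fun x => co x a)).
rewrite co0 co_rvec // nth_rcons size_nseq ltnn eqxx => /eqP.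
by rewrite oner_eq0.
Qed.

Let noncentral_rank1 s a k : s \in shapes -> (size s.2 <= p)%N ->
  (a < s.1)%N -> (k < p)%N ->
  (forall l y, (l < size s.2)%N -> l != k -> sform (nth [::] s.2 l) (unit s.1 a) y = 0) ->
  has_noncentral_rank1 (model R s p).
Proof.
move=> sS sp ap kp H; exists ((unit s.1 a, 0) : model R s p); last exact: (rank_le1_support 0 kp H).
by rewrite model_center ?unit_neq0 //; apply: shapes_nondeg.
Qed.

Let not_dim1 s (a b c d : nat) : s \in shapes -> (size s.2 <= p)%N -> (1 < size s.2)%N ->
  let F k x y := sform (nth [::] s.2 k) (unit s.1 x) (unit s.1 y) in
  F 0%N a b * F 1%N c d <> F 1%N a b * F 0%N c d -> ~ dim1_derived (model R s p).
Proof.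
move=> sS sp s2 F N D; apply: N; apply: (dim1_derived_minor _ D) => //.
exact: ltnW s2.
Qed.

Lemma q3_rank1 : (2 <= p)%N -> has_noncentral_rank1 (model R sh_q3 p).
Proof.
move=> p2; apply: (@noncentral_rank1 _ 1 0) => //; first by lia.
by move=> [|[|]] // y _ _; sform_simp; rewrite !mul0r subrr addr0.
Qed.

Lemma jet_rank1 : (2 <= p)%N -> has_noncentral_rank1 (model R sh_jet p).
Proof.
move=> p2; apply: (@noncentral_rank1 _ 2 1) => //.
by move=> [|[|]] // y _ _; sform_simp; rewrite !mul0r subrr addr0.
Qed.

Lemma f3_no_rank1 : (3 <= p)%N -> ~ has_noncentral_rank1 (model R sh_f3 p).
Proof.
move=> p3 [u uZ /rank_le1_minor H]; move/negP: uZ; apply.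
rewrite model_center //; last exact: shapes_nondeg.
have {}H := H p3.
have := H 0%N 1%N (unit _ 1) (unit _ 2) isT isT.
have := H 0%N 2 (unit _ 0) (unit _ 2) isT isT.
have := H 1%N 2 (unit _ 0) (unit _ 1) isT isT.
sform_simp; rewrite ?mulr0 ?mulr1 ?addr0 ?subr0 ?sub0r => E1 E2 E3.
apply/eqP/co_inj => -[|[|[|]]] // _; rewrite co0; apply/eqP; rewrite -sqrf_eq0; apply/eqP; lra.
Qed.

Lemma h3C_no_rank1 : (2 <= p)%N -> ~ has_noncentral_rank1 (model R sh_h3C p).
Proof.
move=> p3 [u uZ /rank_le1_minor H]; move/negP: uZ; apply.
rewrite model_center //; last exact: shapes_nondeg.
have {}H := H p3.
have := H 0%N 1%N (unit _ 0) (unit _ 1) isT isT.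
have := H 0%N 1%N (unit _ 2) (unit _ 3) isT isT.
sform_simp; rewrite ?mulr0 ?mulr1 ?addr0 ?subr0 ?sub0r ?add0r => E1 E2.
apply/eqP/co_inj => -[|[|[|[|]]]] // _; rewrite co0; nra.
Qed.

Lemma h5_dim1 : (1 <= p)%N -> dim1_derived (model R sh_h5 p).
Proof.
move=> p1; exists ((0, delta_mx 0 (Ordinal p1)) : model R sh_h5 p) => x y.
apply/vlineP; exists (sform (nth [::] sh_h5.2 0) x.1 y.1); congr pair.
  by rewrite scaler0.
apply/rowP => -[[|l] lp]; rewrite !mxE /=; first by rewrite mulr1.
by rewrite mulr0 nth_nil /sform big_nil.
Qed.

Lemma h3h3_not_dim1 : (2 <= p)%N -> ~ dim1_derived (model R sh_h3h3 p).
Proof.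
move=> p2; apply: (@not_dim1 _ 0 1 2 3) => //=.
sform_simp; rewrite !(mulr0, mulr1, mul0r, mul1r, addr0, add0r, subr0, oppr0) => /eqP.
by rewrite oner_eq0.
Qed.

Lemma jet_not_dim1 : (2 <= p)%N -> ~ dim1_derived (model R sh_jet p).
Proof.
move=> p2; apply: (@not_dim1 _ 0 1 0 2) => //=.
sform_simp; rewrite !(mulr0, mulr1, mul0r, mul1r, addr0, add0r, subr0, oppr0) => /eqP.
by rewrite oner_eq0.
Qed.

Lemma h3C_not_dim1 : (2 <= p)%N -> ~ dim1_derived (model R sh_h3C p).
Proof.
move=> p2; apply: (@not_dim1 _ 0 2 0 3) => //=.
sform_simp; rewrite !(mulr0, mulr1, mul0r, mul1r, addr0, add0r, subr0, oppr0) => /eqP.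
by rewrite oner_eq0.
Qed.

Lemma h3h3_noncommuting : (2 <= p)%N -> has_noncommuting_rank1 (model R sh_h3h3 p).
Proof.
move=> p2; exists ((unit 4 0, 0) : model R sh_h3h3 p), ((unit 4 1, 0) : model R sh_h3h3 p).
have p0 : (0 < p)%N by lia.
split.
- apply: (rank_le1_support 0 p0) => -[|[|]] // y _ _.
  by sform_simp; rewrite !mul0r subrr addr0.
- apply: (rank_le1_support 0 p0) => -[|[|]] // y _ _.
  by sform_simp; rewrite !mul0r subrr addr0.
move/(congr1 (fun u : model R sh_h3h3 p => co u.2 0)).
rewrite co_br // co0; sform_simp.
by rewrite !(mulr0, mulr1, mul0r, mul1r, addr0, add0r, subr0, oppr0) => /eqP; rewrite oner_eq0.
Qed.

(** Its rank one elements are combinations of e_2, e_3 and central elements. *)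
Lemma jet_commuting : (2 <= p)%N -> ~ has_noncommuting_rank1 (model R sh_jet p).
Proof.
move=> p2 [u [v [ru rv]]].
have rank1 (w : model R sh_jet p) : rank_le1 w -> co w.1 0 = 0 /\ co w.1 1 = 0.
  move/rank_le1_minor => /(_ p2) H.
  have := H 0%N 1%N (unit _ 0) (unit _ 3) isT isT.
  have := H 0%N 1%N (unit _ 1) (unit _ 2) isT isT.
  sform_simp; rewrite ?mulr0 ?mulr1 ?addr0 ?subr0 ?sub0r ?add0r => E1 E2.
  by split; apply/eqP; rewrite -sqrf_eq0; apply/eqP; lra.
have [u0 u1] := rank1 u ru; have [v0 v1] := rank1 v rv.
apply; congr pair; apply/rowP => -[[|[|k]] kp]; rewrite !mxE /=; sform_simp.
- by rewrite u0 u1 !mul0r subrr addr0.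
- by rewrite u0 u1 v0 v1 !(mul0r, mulr0) subrr !addr0.
by rewrite nth_nil big_nil.
Qed.

End Separate.

(** The dimensions of the algebra and of its center give p and the number of
    generators. Among the shapes with the same number of generators, [sh_f3] and
    [sh_h3C] are those without noncentral rank one elements, [sh_h5] has a derived
    algebra of dimension one, and the rank one elements of [sh_jet] commute while
    those of [sh_h3h3] do not. *)
Theorem model_iso_inj (R : realType) s s' p p' :
  s \in shapes -> s' \in shapes -> (size s.2 <= p)%N -> (size s'.2 <= p')%N ->
  lie_iso (model R s p) (model R s' p') -> s = s' /\ p = p'.
Proof.
move=> sS sS' sp sp' iso.
have pp : p = p'.
  have := lie_iso_center iso.
  by rewrite !model_dim_center //; apply: shapes_nondeg.
split=> //; subst p'; have iso' := lie_iso_sym iso.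
have : s.1 = s'.1.
  by apply/eqP; rewrite -(eqn_add2r p) -!(model_dim R) (lie_iso_dim iso).
move: sS sS' sp sp' iso iso'.
rewrite !inE => /or4P[||| /or4P[]] /eqP -> /or4P[||| /or4P[]] /eqP -> //= sp sp' i i' _;
  exfalso.
- exact: (f3_no_rank1 sp' (noncentral_rank1_iso i (q3_rank1 R sp))).
- exact: (f3_no_rank1 sp (noncentral_rank1_iso i' (q3_rank1 R sp'))).
- exact: (h3h3_not_dim1 sp' (dim1_derived_iso i (h5_dim1 R sp))).
- exact: (jet_not_dim1 sp' (dim1_derived_iso i (h5_dim1 R sp))).
- exact: (h3C_not_dim1 sp' (dim1_derived_iso i (h5_dim1 R sp))).
- exact: (h3h3_not_dim1 sp (dim1_derived_iso i' (h5_dim1 R sp'))).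
- exact: (jet_commuting sp' (noncommuting_rank1_iso i (h3h3_noncommuting R sp))).
- exact: (h3C_no_rank1 sp' (noncommuting_noncentral
           (noncommuting_rank1_iso i (h3h3_noncommuting R sp)))).
- exact: (jet_not_dim1 sp (dim1_derived_iso i' (h5_dim1 R sp'))).
- exact: (jet_commuting sp (noncommuting_rank1_iso i' (h3h3_noncommuting R sp'))).
- exact: (h3C_no_rank1 sp' (noncentral_rank1_iso i (jet_rank1 R sp))).
- exact: (h3C_not_dim1 sp (dim1_derived_iso i' (h5_dim1 R sp'))).
- exact: (h3C_no_rank1 sp (noncommuting_noncentral
           (noncommuting_rank1_iso i' (h3h3_noncommuting R sp')))).
- exact: (h3C_no_rank1 sp (noncentral_rank1_iso i' (jet_rank1 R sp'))).
Qed.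

(** * Killing 2-forms as skew operators *)

Section Biscalar.
Variables (R : realType) (V : vectType R) (b : V -> V -> R).
Hypothesis hb : bilinear_for *%R *%R b.
Implicit Types u v w : V.

Lemma bsDl u v w : b (u + v) w = b u w + b v w.
Proof. by have := hb.1 w 1 u v; rewrite /= scale1r mul1r. Qed.

Lemma bsDr u v w : b w (u + v) = b w u + b w v.
Proof. by have := hb.2 w 1 u v; rewrite /= scale1r mul1r. Qed.

Lemma bs0l w : b 0 w = 0.
Proof. by apply: (addrI (b 0 w)); rewrite -bsDl !addr0. Qed.

Lemma bs0r w : b w 0 = 0.
Proof. by apply: (addrI (b w 0)); rewrite -bsDr !addr0. Qed.

Lemma bsZl c u w : b (c *: u) w = c * b u w.
Proof. by have := hb.1 w c u 0; rewrite /= !addr0 bs0l addr0. Qed.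

Lemma bsZr c u w : b w (c *: u) = c * b w u.
Proof. by have := hb.2 w c u 0; rewrite /= !addr0 bs0r addr0. Qed.

Lemma bsNl u w : b (- u) w = - b u w.
Proof. by rewrite -scaleN1r bsZl mulN1r. Qed.

Lemma bsNr u w : b w (- u) = - b w u.
Proof. by rewrite -scaleN1r bsZr mulN1r. Qed.

Lemma bs_sumr I (r : seq I) (F : I -> V) w :
  b w (\sum_(i <- r) F i) = \sum_(i <- r) b w (F i).
Proof. by elim/big_rec2: _ => [|i x y _ <-]; rewrite ?bs0r ?bsDr. Qed.

Definition bsE := (bsDl, bsDr, bs0l, bs0r, bsZl, bsZr, bsNl, bsNr).

End Biscalar.

Section InnerProduct.
Variables (R : realType) (n : lieAlgebra R) (ip : n -> n -> R).
Hypothesis hip : inner_product ip.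
Implicit Types u v w : n.

Lemma ip_bilinear : bilinear_for *%R *%R ip. Proof. by case: hip. Qed.

Definition ipE := (bsE ip_bilinear).

Lemma ipC u v : ip u v = ip v u. Proof. by case: hip. Qed.

Lemma ip_eq0 u : ip u u = 0 -> u = 0.
Proof.
move=> H; apply: contrapT => /eqP u0; case: hip => _ _ /(_ u u0).
by rewrite H ltxx.
Qed.

Lemma ip_gt0 u : u != 0 -> 0 < ip u u. Proof. by case: hip => _ _; apply. Qed.

Lemma ip_inj u v : (forall w, ip u w = ip v w) -> u = v.
Proof.
move=> H; apply/eqP; rewrite -subr_eq0; apply/eqP/ip_eq0.
by rewrite (bsDl ip_bilinear) (bsNl ip_bilinear) H subrr.
Qed.

Lemma riesz (phi : {scalar n}) : exists a, forall v, ip a v = phi v.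
Proof.
pose B := vbasis {:n}.
pose T (a : n) : 'rV[R]_(\dim {:n}) := \row_i ip a B`_i.
have Tl : linear T by move=> c u v; apply/rowP => i; rewrite !mxE !ipE.
pose L := GRing.isLinear.Build R n 'rV[R]_(\dim {:n}) *:%R T Tl.
pose T' : {linear n -> 'rV[R]_(\dim {:n})} := HB.pack T L.
have T0 u : (forall i : 'I_(\dim {:n}), ip u B`_i = 0) -> u = 0.
  move=> H; apply: ip_eq0; rewrite {2}(coord_vbasis (memvf u)).
  by rewrite (bs_sumr ip_bilinear) big1 // => i _; rewrite !ipE H mulr0.
have kT : (lker (linfun T') == 0)%VS.
  apply/lker0P => x y; rewrite !lfunE /= => /rowP E.
  apply/eqP; rewrite -subr_eq0; apply/eqP/T0 => i.
  by have := E i; rewrite !mxE !ipE => ->; rewrite subrr.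
have : limg (linfun T') = fullv.
  apply/eqP; rewrite eqEdim subvf limg_dim_eq ?(eqP kT) ?capv0 //.
  by rewrite [X in (X <= _)%N]dimvf /dim /= mul1n.
move=> /vspaceP/(_ (\row_i phi B`_i)); rewrite memvf => /memv_imgP[a _].
rewrite lfunE /= => /rowP E; exists a => v.
rewrite (coord_vbasis (memvf v)) (bs_sumr ip_bilinear) linear_sum.
apply: eq_bigr => i _; have := E i; rewrite !mxE => Ei.
by rewrite !ipE -Ei; apply/esym/linearZ.
Qed.

Lemma riesz_fun (f : n -> R) : (forall c u v, f (c *: u + v) = c * f u + f v) ->
  exists a, forall v, ip a v = f v.
Proof.
move=> fl; pose L := GRing.isLinear.Build R n R *%R f fl.
exact: (riesz (HB.pack f L : {scalar n})).
Qed.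

Lemma riesz_operator (b : n -> n -> R) : bilinear_for *%R *%R b ->
  exists A : 'End(n), forall u v, ip (A u) v = b u v.
Proof.
move=> hb.
have [|f fE] := @choice _ _ (fun u a => forall v, ip a v = b u v).
  by move=> u; apply: riesz_fun => c v w; rewrite !(bsE hb).
have fl : linear f by move=> c u v; apply: ip_inj => w; rewrite !ipE !fE !(bsE hb).
pose L := GRing.isLinear.Build R n n *:%R f fl.
by exists (linfun (HB.pack f L : {linear n -> n})) => u v; rewrite lfunE /= fE.
Qed.

End InnerProduct.

Section Killing.
Variables (R : realType) (n : lieAlgebra R).
Implicit Types u v w x y : n.

(** The operators of the left-invariant Killing 2-forms, see
    [killing_form_operator] and [operator_killing_form]. *)
Record killing_operator (ip : n -> n -> R) (A : 'End(n)) : Prop := KillingOperator {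
  ko_ip : inner_product ip;
  ko_neq0 : A != 0;
  ko_skew : forall u v, ip (A u) v = - ip u (A v);
  ko_br : forall u v, A [< u, v >] = 3 *: [< A u, v >]
}.

Hypothesis n2 : two_step n.

(** The differential of the left translation that sends x to the identity. *)
Definition tr x : 'End(n) := (\1 - 2^-1 *: ad x)%VF.

Lemma trE x u : tr x u = u - 2^-1 *: [< x, u >].
Proof. by rewrite add_lfunE opp_lfunE scale_lfunE id_lfunE adE. Qed.

Lemma tr_dL_inv x u : dL (grp_inv x) u = tr x u.
Proof. by rewrite trE /dL /grp_inv brNl scalerN. Qed.

Lemma tr0 u : tr 0 u = u.
Proof. by rewrite trE br0l scaler0 subr0. Qed.

Lemma dL_tr x u : dL x (tr x u) = u.
Proof. by rewrite trE /dL !brE (br_brr n2) !scaler0 oppr0 addr0; vring. Qed.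

Lemma tr_dL x u : tr x (dL x u) = u.
Proof. by rewrite trE /dL !brE (br_brr n2) !scaler0 addr0; vring. Qed.

(** The left-invariant tensor with value b at the identity. *)
Definition pull (b : n -> n -> R) x u v : R := b (tr x u) (tr x v).

Lemma left_metricE ip : left_metric ip = pull ip.
Proof.
by apply/funext => x; apply/funext => u; apply/funext => v; rewrite /pull -!tr_dL_inv.
Qed.

Lemma br_trl x u v : [< tr x u, v >] = [< u, v >].
Proof. by rewrite !trE !brE (br_brl n2) scaler0 oppr0 addr0. Qed.

Lemma br_trr x u v : [< u, tr x v >] = [< u, v >].
Proof. by rewrite brC br_trl -brC. Qed.

Lemma tr_inj x : injective (tr x).
Proof. exact: can_inj (dL_tr x). Qed.

Lemma derive1_quadratic (a b c : R) : derive1 (fun t : R => a + t * b + t ^+ 2 * c) 0 = b.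
Proof.
have D : is_derive (0 : R) 1 (fun t : R => a + t * b + t ^+ 2 * c) b.
  by apply: is_derive_eq; rewrite /GRing.scale /=; ring.
by rewrite derive1E derive_val.
Qed.

(** Along a line, [tr] is affine in the base point, so that the tensor is
    quadratic; its derivative only involves brackets, which [tr] fixes. *)
Lemma dird_pull (b : n -> n -> R) x u v w : bilinear_for *%R *%R b ->
  dird (fun y => pull b y v w) x u =
  - 2^-1 * (b [< u, v >] (tr x w) + b (tr x v) [< u, w >]).
Proof.
move=> hb; rewrite /dird /pull /=.
set d := RHS; rewrite -(derive1_quadratic (b (tr x v) (tr x w)) d
  (4^-1 * b [< u, v >] [< u, w >])).
congr derive1; apply/funext => t.
by rewrite /d !trE !brE !(bsE hb); field.
Qed.


Lemma left_invariant_pull (al : n -> n -> n -> R) : left_invariant al ->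
  forall x u v, al x u v = pull (al 0) x u v.
Proof.
move=> li x u v; rewrite /pull -!tr_dL_inv -(li (grp_inv x) x u v); congr (al _ _ _).
by rewrite /grp_mul /grp_inv brNl brr oppr0 scaler0 addr0 addNr.
Qed.

Lemma pull_left_invariant (b : n -> n -> R) : left_invariant (pull b).
Proof.
have E a x u : tr (grp_mul a x) (dL a u) = tr x u.
  rewrite !trE /grp_mul /dL !brE !(br_brr n2) !(br_brl n2) !scaler0 !addr0.
  by vring.
by move=> a x u v; rewrite /pull !E.
Qed.

Section ToOperator.
Variables (ip : n -> n -> R) (A : 'End(n)).
Hypotheses (hip : inner_product ip) (skew : forall u v, ip (A u) v = - ip u (A v)).

(** The Killing equation at the identity, in the direction of u, evaluated at
    u and w: the right-hand side vanishes, and the covariant derivative is given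
    by the Koszul formula. *)
Definition killing_at_one : Prop := forall u w,
  2 * ip u [< u, A w >] - ip w [< u, A u >] - ip u [< w, A u >]
  + ip (A u) [< u, w >] = 0.

Lemma killing_at_one_polar : killing_at_one -> forall u v w,
  2 * ip u [< v, A w >] + 2 * ip v [< u, A w >]
  - ip w [< u, A v >] - ip w [< v, A u >]
  - ip u [< w, A v >] - ip v [< w, A u >]
  + ip (A u) [< v, w >] + ip (A v) [< u, w >] = 0.
Proof.
move=> H u v w; have := H (u + v) w; have := H u w; have := H v w.
by rewrite !(linearD A) !brE !(ipE hip) => *; lra.
Qed.

(** Polarizing with one or two central arguments leaves few terms, and forces
    A to preserve the center and to commute with brackets up to a factor 3. *)
Lemma killing_at_one_br : killing_at_one ->
  forall u v, A [< u, v >] = 3 *: [< A u, v >].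
Proof.
move=> /killing_at_one_polar H.
have AZ z : z \in centerv n -> A z \in centerv n.
  have E x z1 z2 : z1 \in centerv n -> z2 \in centerv n ->
      2 * ip z1 [< x, A z2 >] = ip z2 [< x, A z1 >].
    move=> z1Z z2Z; have := H x z1 z2.
    by rewrite !(center_brl _ z1Z, center_brr _ z1Z, center_brl _ z2Z, center_brr _ z2Z);
      rewrite !(ipE hip) => *; lra.
  move=> zZ; apply/centerP => x; apply: (ip_eq0 hip).
  have wZ := br_center n2 x (A z).
  have E1 := E x z _ zZ wZ; have E2 := E x _ z wZ zZ.
  by rewrite brC !(ipE hip); lra.
have K u v : A [< u, v >] = 2 *: [< u, A v >] + [< A u, v >].
  set d := RHS; apply/eqP; rewrite -subr_eq0; apply/eqP/(ip_eq0 hip).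
  have [z zE] : exists z, z = A [< u, v >] - d by eexists.
  rewrite -zE; have zZ : z \in centerv n.
    by rewrite zE memvB ?AZ ?memvD ?memvZ ?br_center.
  have := H u z v; have AzZ := AZ z zZ.
  rewrite !(center_brl _ zZ, center_brr _ zZ, center_brr _ AzZ).
  rewrite (brC v (A u)) (skew z) !(ipE hip) => E.
  by rewrite {2}zE /d !(ipE hip); lra.
have AC u v : [< u, A v >] = [< A u, v >].
  apply/eqP; rewrite -subr_eq0; apply/eqP.
  have E1 := K u v; have E2 := K v u.
  move: E2; rewrite brC linearN /= E1 (brC v (A u)) (brC (A v) u) => E2.
  rewrite -[LHS]addr0 -(subrr (- (2 *: [< u, A v >] + [< A u, v >]))).
  by rewrite {2}E2; vring.
by move=> u v; rewrite K AC; vring.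
Qed.

Lemma br_killing_at_one : (forall u v, A [< u, v >] = 3 *: [< A u, v >]) ->
  killing_at_one.
Proof.
move=> H u w.
have AC s t : [< s, A t >] = [< A s, t >].
  have := H s t; rewrite brC linearN /= H (brC s (A t)) -scalerN => /esym.
  by move/(congr1 (fun v => 3^-1 *: v)); rewrite !scalerA mulVf // !scale1r.
have u0 : [< u, A u >] = 0.
  apply: scalar_ext => phi; have := congr1 phi (AC u u).
  by rewrite (brC (A u)) linearN linear0; lra.
by rewrite u0 (brC w (A u)) AC skew H !(ipE hip); ring.
Qed.

End ToOperator.

Lemma killing_form_operator (ip : n -> n -> R) al : inner_product ip ->
  killing_2form (left_metric ip) al -> left_invariant al ->
  (exists x u v, al x u v != 0) -> exists A, killing_operator ip A.
Proof.
move=> hip [is2 [G [Gb Gs Gm] Kil]] /left_invariant_pull alE nz.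
have hb : bilinear_for *%R *%R (al 0) := (is2 0).1.
have [A AE] := riesz_operator hip hb.
have b0 u : al 0 u u = 0 by case: (is2 0).
have bC u v : al 0 u v = - al 0 v u.
  by have := b0 (u + v); rewrite !(bsE hb) !b0; lra.
have skew u v : ip (A u) v = - ip u (A v) by rewrite (ipC hip u) !AE bC.
exists A; split=> //.
  apply/eqP => A0; case: nz => x [u [v /eqP]]; apply.
  by rewrite alE /pull -AE A0 zero_lfunE (bs0l (ip_bilinear hip)).
apply: (killing_at_one_br hip skew) => u w.
have compat s t r : - 2^-1 * (ip [< s, t >] r + ip t [< s, r >])
    = ip (G 0 s t) r + ip t (G 0 s r).
  have := Gm 0 s t r; rewrite left_metricE /pull !tr0 => <-.
  by rewrite dird_pull ?tr0 //; exact: ip_bilinear.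
have koszul s t r : ip (G 0 s t) r = - 2^-1 * (ip t [< s, r >] + ip s [< t, r >]).
  have := compat s t r; have := compat t r s; have := compat r s t.
  rewrite (Gs 0 r s) (Gs 0 t s) (Gs 0 r t) (brC t s) (brC r t) (brC r s) !(ipE hip).
  rewrite (ipC hip _ (G 0 s t)) (ipC hip _ (G 0 s r)) (ipC hip _ (G 0 t r)).
  by rewrite (ipC hip [< s, t >]) (ipC hip [< t, r >]) (ipC hip [< s, r >]); lra.
have dal s t r : dird (fun y => al y t r) 0 s =
    - 2^-1 * (al 0 [< s, t >] r + al 0 t [< s, r >]).
  by rewrite (_ : (fun y => _) = fun y => pull (al 0) y t r) ?dird_pull ?tr0 //;
    apply/funext => y; rewrite alE.
have := Kil (fun=> u) 0 u w; rewrite /cov_deriv /ext_deriv.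
have -> : (fun y => al y u u) = (fun y => pull (al 0) y u u).
  by apply/funext => y; rewrite alE.
rewrite dird_pull // !tr0 !dal brr !(bsE hb).
rewrite -(AE (G 0 u u)) -(AE u (G 0 u w)) -(AE u [< u, w >]) (bC [< w, u >]).
rewrite (brC w u) (bsNr hb) -(AE u [< u, w >]) (skew (G 0 u u)).
rewrite (ipC hip (A u) (G 0 u w)) !koszul (brC w (A u)) !(ipE hip).
by move=> ?; lra.
Qed.


(** The connection is the left translate of the bilinear map that the Koszul
    formula defines at the identity. *)
Lemma levi_civita_exists (ip : n -> n -> R) : inner_product ip ->
  exists2 G, levi_civita (left_metric ip) G &
    forall x u v w, ip (tr x (G x u v)) w =
      - 2^-1 * (ip (tr x v) [< u, w >] + ip (tr x u) [< v, w >]).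
Proof.
move=> hip; have hb := ip_bilinear hip.
have [|K KE] := @choice _ _ (fun (st : n * n) a => forall r, ip a r =
    - 2^-1 * (ip st.2 [< st.1, r >] + ip st.1 [< st.2, r >])).
  by move=> st; apply: (riesz_fun hip) => c v w; rewrite !brE !(ipE hip); ring.
pose G x u v := dL x (K (tr x u, tr x v)).
have GE x u v w : ip (tr x (G x u v)) w =
      - 2^-1 * (ip (tr x v) [< u, w >] + ip (tr x u) [< v, w >]).
  by rewrite tr_dL KE /= !br_trl.
clearbody G; exists G => //; split=> [x|x u v|x u v w].
- split=> w c u v /=; apply: (@tr_inj x); apply: (ip_inj hip) => y;
    by rewrite linearP !(ipE hip) !GE linearP !brE !(ipE hip); ring.
- by apply: (@tr_inj x); apply: (ip_inj hip) => y; rewrite !GE addrC.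
rewrite left_metricE dird_pull // /pull.
rewrite (ipC hip (tr x v) (tr x (G x u w))) !GE !br_trr (brC w v) !(ipE hip).
by rewrite (ipC hip (tr x w)); ring.
Qed.

(** The covariant derivative of the form is alternating in its three arguments:
    in the first two because it satisfies the polarized Killing equation at the
    identity. As the connection is symmetric, the exterior derivative is the
    alternating sum of the covariant derivatives, which is then three times each
    of them. *)
Lemma operator_killing_form (ip : n -> n -> R) A : killing_operator ip A ->
  has_left_invariant_killing_2form n.
Proof.
case=> hip A0 skew Abr; exists ip => //.
have [G GLC GE] := levi_civita_exists hip.
pose b u v := ip (A u) v.
have hb : bilinear_for *%R *%R b.
  by split=> w c u v; rewrite /b ?(linearD A) ?(linearZ_LR A) /= ?linearP !(ipE hip).
have b0 u : b u u = 0.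
  by have := skew u u; rewrite /b (ipC hip u); lra.
have bC u v : b u v = - b v u.
  by have := b0 (u + v); rewrite !(bsE hb) !b0; lra.
exists (pull b); split; last 2 first.
- exact: pull_left_invariant.
- have [u Au] : exists u, A u != 0.
    apply: contrapT => H; move/eqP: A0; apply; apply/lfunP => u.
    by rewrite zero_lfunE; apply/eqP/negPn/negP => K; apply: H; exists u.
  exists 0, u, (A u); rewrite /pull !tr0 /b; apply/eqP => H.
  by move/eqP: Au; apply; apply: (ip_eq0 hip).
split.
  move=> x; split=> [|u]; last exact: b0.
  by split=> w c u v /=; rewrite /pull linearP !(bsE hb).
exists G => // Y x v w; move: (Y x) => u {Y}.
have [_ Gs _] := GLC.
pose E u v w := cov_deriv G (pull b) x u v w.
have EC s t r : E s t r = - E s r t.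
  rewrite /E /cov_deriv !dird_pull // /pull.
  by rewrite (bC (tr x (G x s t))) (bC (tr x t)) (bC [< s, t >]) (bC (tr x t)); ring.
have EE s t r : E s t r =
    - 2^-1 * (b [< s, t >] (tr x r) + b (tr x t) [< s, r >])
    - 2^-1 * (ip (tr x t) [< s, A (tr x r) >] + ip (tr x s) [< t, A (tr x r) >])
    + 2^-1 * (ip (tr x r) [< s, A (tr x t) >] + ip (tr x s) [< r, A (tr x t) >]).
  rewrite /E /cov_deriv dird_pull // /pull (bC (tr x t) (tr x (G x s r))).
  by rewrite {3 4}/b !(skew (tr x (G _ _ _))) !GE; ring.
have E1 s t r : E s t r = - E t s r.
  have := killing_at_one_polar hip (br_killing_at_one hip skew Abr)
            (tr x s) (tr x t) (tr x r).
  by rewrite !br_trl !br_trr !EE (brC t s) (bsNl hb) /b => H; lra.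
have -> : ext_deriv (pull b) x u v w = E u v w - E v u w + E w u v.
  rewrite /E /cov_deriv /ext_deriv (Gs x v u) (Gs x w u) (Gs x w v).
  by rewrite /pull (bC (tr x v) (tr x (G x u w))); ring.
by rewrite -/(E u v w) (E1 v u) (E1 w u) (EC u w); field.
Qed.

End Killing.

(** * Algebras with a Killing operator *)

Section Structure.
Variables (R : realType) (n : lieAlgebra R) (ip : n -> n -> R) (A : 'End(n)).
Hypotheses (n2 : two_step n) (kA : killing_operator ip A).
Implicit Types u v w x y z : n.

Let hip : inner_product ip := ko_ip kA.
Let skew u v : ip (A u) v = - ip u (A v). Proof. exact: ko_skew kA u v. Qed.
Let Abr u v : A [< u, v >] = 3 *: [< A u, v >]. Proof. exact: ko_br kA u v. Qed.

Let AD u v : A (u + v) = A u + A v. Proof. exact: linearD. Qed.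
Let AS c u : A (c *: u) = c *: A u. Proof. exact: linearZ. Qed.

Let brA u v : [< A u, v >] = 3^-1 *: A [< u, v >].
Proof. by rewrite Abr scalerA mulVf // scale1r. Qed.

Let brAr u v : [< u, A v >] = 3^-1 *: A [< u, v >].
Proof. by rewrite brC brA brC linearN scalerN opprK. Qed.

Let brAA u : [< u, A u >] = 0. Proof. by rewrite brAr brr linear0 scaler0. Qed.

Let A_center z : z \in centerv n -> A z \in centerv n.
Proof.
by move=> zZ; apply/centerP => x; rewrite brA center_brl // linear0 scaler0.
Qed.

Let ip_A u : ip u (A u) = 0.
Proof. by have := skew u u; rewrite (ipC hip (A u)); lra. Qed.

Let A_inj_img u : A (A u) = 0 -> A u = 0.
Proof. by move=> H; apply: (ip_eq0 hip); rewrite skew H (bs0r (ip_bilinear hip)) oppr0. Qed.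

Let free_A u : u != 0 -> A u != 0 -> free [:: u; A u].
Proof.
move=> u0 Au0; apply: free2 => //; apply/vlineP => -[k E].
have := ip_A u; rewrite E (bsZr (ip_bilinear hip)) => /eqP; rewrite mulf_eq0.
have /lt0r_neq0 /negbTE -> := ip_gt0 hip u0; rewrite orbF => /eqP k0.
by move: Au0; rewrite E k0 scale0r eqxx.
Qed.

Let ker_img : (limg A :&: lker A = 0)%VS.
Proof.
apply/eqP; rewrite -subv0; apply/subvP => v /memv_capP[/memv_imgP[u _ ->]].
by rewrite memv_ker memv0 => /eqP /A_inj_img ->.
Qed.

(** The derived algebra lies in the kernel of A, and a skew operator has
    complementary kernel and image. *)
Lemma central_image : (forall u, A u \in centerv n) ->
  (\dim (derivedv n) + 2 <= \dim (centerv n))%N.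
Proof.
move=> AZ; have [u Au] : exists u, A u != 0.
  apply: contrapT => H; move/eqP: (ko_neq0 kA); apply; apply/lfunP => u.
  by rewrite zero_lfunE; apply/eqP/negPn/negP => K; apply: H; exists u.
have AAu : A (A u) != 0 by apply: contraNneq Au => /A_inj_img ->.
have IZ : (limg A <= centerv n)%VS.
  by apply/subvP => _ /memv_imgP[v _ ->].
have DK : (derivedv n <= lker A)%VS.
  by apply: derived_sub => v w; rewrite memv_ker Abr center_brl // scaler0.
have DI : (derivedv n :&: limg A = 0)%VS.
  apply/eqP; rewrite -subv0 -ker_img capvC; exact: capvS.
have d2 : (2 <= \dim (limg A))%N.
  apply: (free_leq_dim (free_A Au AAu)) => v.
  by rewrite !inE => /orP[] /eqP ->; apply: memv_img (memvf _).
apply: leq_trans (_ : \dim (derivedv n + limg A) <= _)%N.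
  by rewrite dimv_disjoint_sum // leq_add2l.
by apply: dimvS; rewrite subv_add derived_center.
Qed.

(** The elements x, A x, y, A y, z, z' are candidates for a real basis of the
    complex Heisenberg algebra. *)
Section Noncentral.
Variables x y : n.
Let z : n := [< x, y >].
Let z' : n := [< A x, y >].
Hypothesis z'0 : z' != 0.

Let Az : A z = 3 *: z'. Proof. exact: Abr. Qed.

Let Az0 : A z != 0.
Proof. by rewrite Az scaler_eq0 negb_or z'0 andbT pnatr_eq0. Qed.

Let z0 : z != 0. Proof. by apply: contraNneq Az0 => ->; rewrite linear0. Qed.

Let fz : free [:: z; z'].
Proof.
apply: free2P => a b E; have /free2_coef/(_ a (b / 3)) := free_A z0 Az0.
by rewrite Az scalerA divfK // => /(_ E)[-> ?]; split=> //; lra.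
Qed.

Let zZ : z \in centerv n. Proof. exact: br_center. Qed.
Let z'Z : z' \in centerv n. Proof. exact: br_center. Qed.

Let xAy : [< x, A y >] = z'. Proof. by rewrite brAr -brA. Qed.
Let AxAy : [< A x, A y >] = 3^-1 *: A z'. Proof. exact: brAr. Qed.

Let br_x a b c d : [< a *: x + (b *: A x + (c *: y + d *: A y)), x >]
  = - (c *: z + d *: z').
Proof. by rewrite brC !brE brAA xAy -/z; vring. Qed.

Let br_y a b c d : [< a *: x + (b *: A x + (c *: y + d *: A y)), y >]
  = a *: z + b *: z'.
Proof. by rewrite !brE (brC (A y)) brAA -/z -/z'; vring. Qed.

Lemma indep_quadruple : indep_mod_center [:: x; A x; y; A y].
Proof.
apply/indep4P => a b c d /centerP H; have := H x; have := H y; rewrite br_x br_y.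
move=> /(free2_coef fz)[-> ->] /eqP; rewrite oppr_eq0 => /eqP.
by move=> /(free2_coef fz)[-> ->].
Qed.

Lemma dim_center_ge2 : (2 <= \dim (centerv n))%N.
Proof.
by apply: (free_leq_dim fz) => v; rewrite !inE => /orP[] /eqP ->.
Qed.

(** On the plane spanned by z and z', the skew operator A is a multiple of a
    rotation as soon as it preserves this plane. *)
Let Az'_span a b : A z' = a *: z + b *: z' -> exists2 m, m != 0 & A z' = - (3 * m ^+ 2) *: z.
Proof.
move=> E; have zz' : ip z z' = 0.
  have := ip_A z; rewrite Az (bsZr (ip_bilinear hip)) => /eqP.
  by rewrite mulf_eq0 pnatr_eq0 /= => /eqP.
have p := ip_gt0 hip z0; have p' := ip_gt0 hip z'0.
have b0 : b = 0.
  have := ip_A z'; rewrite E !(ipE hip) (ipC hip z') zz' mulr0 add0r => /eqP.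
  by rewrite mulf_eq0 (gt_eqF p') orbF => /eqP.
have := skew z z'; rewrite Az E b0 !(ipE hip) mul0r addr0 => e.
have a0 : a < 0.
  by rewrite -(pmulr_llt0 _ p); lra.
exists (Num.sqrt (- a / 3)); first by rewrite gt_eqF // sqrtr_gt0; lra.
rewrite sqr_sqrtr; last by lra.
by rewrite scale0r addr0; congr (_ *: _); field.
Qed.

(** Bracketing with y an expression of A (A x) in terms of x, A x, y and A y shows
    that A preserves the plane of z and z'. *)
Lemma corank4_h3C : corank n = 4 ->
  lie_iso n (model R sh_h3C (\dim (centerv n))).
Proof.
move=> q4; have [a [s sZ E]] := coord_gen (A (A x)) indep_quadruple (esym q4).
move: E; unroll => E.
have [m m0 Az'] : exists2 m, m != 0 & A z' = - (3 * m ^+ 2) *: z.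
  apply: (@Az'_span (3 * a 0%N) (3 * a 1%N)).
  have : [< A (A x), y >] = a 0%N *: z + a 1%N *: z'.
    by rewrite E brDl (center_brl _ sZ) addr0 br_y.
  rewrite brA -/z' => /(congr1 (fun v => 3 *: v)).
  by rewrite scalerA divff // scale1r => ->; vring.
have fX : free [:: z; m^-1 *: z'].
  apply: free2P => c d; rewrite scalerA => /(free2_coef fz)[-> /eqP].
  by rewrite mulf_eq0 invr_eq0 (negbTE m0) orbF => /eqP ->.
apply: (@model_present _ _ sh_h3C n2 _
    (fun i => [:: x; m^-1 *: A x; y; m^-1 *: A y]`_i)) fX _ _ _ => //.
- exact: shapes_nondeg.
- by move=> v; rewrite !inE => /orP[] /eqP ->; rewrite ?memvZ ?br_derived.
- check_brackets; rewrite ?brE //.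
  + by rewrite brAA scaler0.
  + by rewrite xAy.
  + by rewrite AxAy Az'; vfield.
  + by rewrite brAA scaler0.
Qed.

Lemma indep_extra v w :
  [< v, x >] = 0 -> [< v, y >] = 0 -> [< w, x >] = 0 -> [< w, y >] = 0 ->
  (forall e f, e *: v + f *: w \in centerv n -> e = 0 /\ f = 0) ->
  indep_mod_center [:: x; A x; y; A y; v; w].
Proof.
move=> vx vy wx wy H; apply: indep6 => a b c d e f.
set u := a *: x + _ => uZ.
have E : u = (a *: x + (b *: A x + (c *: y + d *: A y))) + (e *: v + f *: w).
  by rewrite /u; vring.
have /centerP K := uZ; have := K x; have := K y.
rewrite E !(brDl (_ + _) (_ + _)) br_x br_y !brE vx vy wx wy !scaler0 !addr0.
move=> /(free2_coef fz)[a0 b0] /eqP; rewrite oppr_eq0 => /eqP.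
move=> /(free2_coef fz)[c0 d0]; split=> //; apply: H.
by move: uZ; rewrite E a0 b0 c0 d0 !scale0r !add0r.
Qed.

(** The center is the plane of z and z', and A^2 is -9 m^2 on it, hence -m^2 modulo
    the center. If v commutes with x and y, then so does A v, and both commute
    with A x, A y; as x, A x, y, A y, v, A v generate modulo the center, v is
    central. *)
Lemma corank6_false : corank n = 6 -> \dim (centerv n) = 2 -> False.
Proof.
move=> q6 d2.
have ZE : centerv n = <<[:: z; z']>>%VS.
  apply/esym/eqP; rewrite eqEdim d2; move: (fz) => /eqP -> /=.
  by rewrite andbT; apply/span_subvP => v; rewrite !inE => /orP[] /eqP ->.
have Zcoef v : v \in centerv n -> exists a b, v = a *: z + b *: z'.
  by rewrite ZE => /span2P.
have [a [b /Az'_span[m m0 Az']]] := Zcoef _ (A_center z'Z).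
have AAZ v : v \in centerv n -> A (A v) = - (9 * m ^+ 2) *: v.
  move=> /Zcoef[c [d ->]].
  rewrite !(AD, AS) Az !AS Az' !AS Az.
  by vring.
have AA v : A (A v) + m ^+ 2 *: v \in centerv n.
  apply/centerP => w; rewrite !brE brA brA AS AAZ ?br_center //.
  by vfield.
have [|v [vZ xv yv]] := common_centralizer (br_center n2 x) (br_center n2 y).
  by rewrite q6 d2.
have vx : [< v, x >] = 0 by rewrite brC xv oppr0.
have vy : [< v, y >] = 0 by rewrite brC yv oppr0.
have Avx : [< A v, x >] = 0 by rewrite brA vx linear0 scaler0.
have Avy : [< A v, y >] = 0 by rewrite brA vy linear0 scaler0.
have iX6 : indep_mod_center [:: x; A x; y; A y; v; A v].
  apply: indep_extra => // e f H.
  (* multiply e + f A by its conjugate e - f A, using A^2 = - m^2 *)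
  have : e *: (e *: v + f *: A v) - f *: A (e *: v + f *: A v)
      + f ^+ 2 *: (A (A v) + m ^+ 2 *: v) \in centerv n.
    by rewrite memvD ?memvB ?memvZ ?A_center.
  rewrite AD !AS.
  rewrite (_ : _ + _ = (e ^+ 2 + m ^+ 2 * f ^+ 2) *: v); last by vring.
  move=> K; have E : e ^+ 2 + m ^+ 2 * f ^+ 2 = 0.
    apply: contraNeq vZ => E0; rewrite -[v](scalerK E0); exact: memvZ.
  have [] : e ^+ 2 = 0 /\ m ^+ 2 * f ^+ 2 = 0.
    by have := sqr_ge0 e; have := mulr_ge0 (sqr_ge0 m) (sqr_ge0 f); split; lra.
  by move=> /eqP; rewrite sqrf_eq0 => /eqP -> /eqP;
    rewrite mulf_eq0 !sqrf_eq0 (negbTE m0) => /eqP.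
move/negP: vZ; apply; apply: (centralP_gen iX6); first by rewrite q6.
move=> e; rewrite !inE => /or4P[/eqP ->|/eqP ->|/eqP ->|/or3P[] /eqP ->] //.
- by rewrite brAr vx linear0 scaler0.
- by rewrite brAr vy linear0 scaler0.
- exact: brr.
Qed.

End Noncentral.

(** The orthogonal of the center has odd dimension and is preserved by A, so that
    it contains some v <> 0 with A v = 0. Such a v commutes with the image of A,
    hence not with some k0 in its kernel; and A x, A (A x), A y, A (A y), v, k0
    are six independent elements modulo the center. *)
Lemma corank5_false x y : [< A x, y >] != 0 -> corank n = 5 -> False.
Proof.
move=> xy q5.
have [v vZ Av0] : exists2 v, v \notin centerv n & A v = 0.
  pose zb := vbasis (centerv n); pose p := \dim (centerv n).
  pose T (u : n) : 'rV[R]_p := \row_i ip u zb`_i.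
  have Tl : linear T by move=> c u v; apply/rowP => i; rewrite !mxE !(ipE hip).
  pose L := GRing.isLinear.Build R n 'rV[R]_p *:%R T Tl.
  pose T' : {linear n -> 'rV[R]_p} := HB.pack T L.
  pose W := lker (linfun T').
  have WP u : reflect (forall t, t \in centerv n -> ip u t = 0) (u \in W).
    rewrite memv_ker lfunE /=; apply: (iffP eqP) => [/rowP E t tZ | H].
      rewrite (coord_vbasis tZ) (bs_sumr (ip_bilinear hip)) big1 // => i _.
      by have := E i; rewrite !mxE (bsZr (ip_bilinear hip)) => ->; rewrite mulr0.
    apply/rowP => i; rewrite !mxE; apply: H; apply: vbasis_mem.
    by apply: mem_nth; rewrite size_tuple.
  have WZ u : u \in W -> u \in centerv n -> u = 0.
    by move=> /WP H /H; apply: ip_eq0.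
  have dW : \dim W = 5%N.
    have WZ0 : (W :&: centerv n = 0)%VS.
      apply/eqP; rewrite -subv0; apply/subvP => u /memv_capP[uW uZ].
      by rewrite memv0 (WZ u).
    have := limg_ker_dim (linfun T') fullv; rewrite capfv -/W.
    have := dimvS (subvf (limg (linfun T'))); rewrite [X in (_ <= X)%N]dimvf /dim /= mul1n.
    have := dimvS (subvf (W + centerv n)); rewrite dimv_disjoint_sum //.
    by have := corankE n; rewrite q5 /p; lia.
  pose wb := vbasis W.
  pose M : 'M[R]_(\dim W) := \matrix_(i, j) ip (A wb`_i) wb`_j.
  have [||a /rV0Pn[i0 ai0] aM] := @odd_skew_kernel R _ M; first by rewrite dW.
    by apply/matrixP => i j; rewrite !mxE skew (ipC hip).
  pose v := \sum_(i < \dim W) a 0 i *: wb`_i.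
  have wbW (i : 'I_(\dim W)) : wb`_i \in W.
    by apply: vbasis_mem; apply: mem_nth; rewrite size_tuple.
  have vW : v \in W by apply: memv_suml => i _; apply/memvZ/wbW.
  exists v.
    apply: contraNN ai0 => vZ; apply/eqP.
    have := WZ v vW vZ; have := basis_free (vbasisP W).
    by move=> /freeP H /H.
  have AvW : A v \in W.
    by apply/WP => t tZ; rewrite skew (WP _ vW) ?oppr0 //; apply: A_center.
  apply: (ip_eq0 hip); rewrite {2}(coord_vbasis AvW) (bs_sumr (ip_bilinear hip)).
  apply: big1 => j _; rewrite (bsZr (ip_bilinear hip)).
  suff -> : ip (A v) wb`_j = 0 by rewrite mulr0.
  transitivity ((a *m M) 0 j); last by rewrite aM mxE.
  rewrite (ipC hip) linear_sum (bs_sumr (ip_bilinear hip)) mxE.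
  apply: eq_bigr => i _; rewrite linearZ (bsZr (ip_bilinear hip)) mxE.
  by rewrite (ipC hip).
have [k vk] := notin_centerP vZ.
have vA u : [< v, A u >] = 0 by rewrite brAr -brA Av0 br0l.
have [k0 k0K vk0] : exists2 k0, A k0 = 0 & [< v, k0 >] <> 0.
  have : k \in (lker A + limg A)%VS.
    suff -> : (lker A + limg A)%VS = fullv by apply: memvf.
    apply/eqP; rewrite eqEdim subvf dimv_disjoint_sum; last by rewrite capvC ker_img.
    by have := limg_ker_dim A fullv; rewrite capfv => ->; apply: leqnn.
  case/memv_addP => k0 k0K [_ /memv_imgP[k1 _ ->] E]; exists k0.
    by apply/eqP; rewrite -memv_ker.
  by move=> H; apply: vk; rewrite E brDr H vA addr0.
have Ak u : A u = 0 -> [< u, A x >] = 0 /\ [< u, A y >] = 0.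
  by move=> u0; rewrite !brAr -!brA u0 !br0l.
have xy' : [< A (A x), A y >] != 0.
  rewrite (brA (A x)) brAr (brA x) !AS !scaler_eq0 !invr_eq0 pnatr_eq0 /=.
  by apply: contraNneq xy => /A_inj_img/A_inj_img H; rewrite brA H scaler0.
have [vx vy] := Ak v Av0; have [kx ky] := Ak k0 k0K.
suff /indep_leq : indep_mod_center [:: A x; A (A x); A y; A (A y); v; k0].
  by rewrite q5.
apply: indep_extra => // e f /centerP H; have := H v; have := H k0.
rewrite !brE !scaler0 addr0 add0r (brC k0) => /eqP; rewrite scaler_eq0.
move/eqP/negbTE: (vk0) => -> /[!orbF] /eqP -> /eqP.
by rewrite scaler_eq0 oppr_eq0; move/eqP/negbTE: vk0 => -> /[!orbF] /eqP ->.
Qed.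

Theorem killing_dichotomy : (lie_dim n <= 8)%N ->
  (\dim (derivedv n) + 2 <= \dim (centerv n))%N \/
  lie_iso n (model R sh_h3C (\dim (centerv n))) /\
    (2 <= \dim (centerv n) <= 3)%N.
Proof.
move=> n8; have [AZ | /existsNP[x /negP AxZ]] := pselect (forall u, A u \in centerv n).
  by left; apply: central_image.
have [y /eqP xy] := notin_centerP AxZ.
have q4 := indep_leq (indep_quadruple xy); have d2 := dim_center_ge2 xy; have qE := corankE n.
rewrite -/(lie_dim n) in qE.
have : corank n \in iota 4 3 by rewrite mem_iota /= in q4 *; lia.
rewrite !inE => /or3P[] /eqP q.
- have iso := corank4_h3C xy q.
  have [d4 | d3] := leqP 4 (\dim (centerv n)); last by right; split=> //; lia.
  left; have := lie_iso_derived (lie_iso_sym iso).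
  have := model_dim_derived R sh_h3C (\dim (centerv n)) => /=; lia.
- by case: (corank5_false xy q).
by case: (corank6_false xy q); lia.
Qed.

End Structure.

(** * Models with a Killing operator *)

Section Constructions.
Variable R : realType.

Lemma killing_operator_iso (n m : lieAlgebra R) ip (A : 'End(m)) :
  lie_iso n m -> killing_operator ip A ->
  exists ip', exists A' : 'End(n), killing_operator ip' A'.
Proof.
case=> f [g fK gK] fbr [hip A0 skew Abr].
have hb := ip_bilinear hip; pose h u := g (A (f u)).
have gl := can2_linear fK gK.
have hl : linear h by move=> c u v; rewrite /h !linearP gl.
pose L := GRing.isLinear.Build R n n *:%R h hl.
pose A' : 'End(n) := linfun (HB.pack h L : {linear n -> n}).
have fA u : f (A' u) = A (f u) by rewrite lfunE /= /h gK.
exists (fun u v => ip (f u) (f v)), A'; split.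
- split=> [|u v|u u0].
  + by split=> w c u v /=; rewrite linearP !(bsE hb).
  + exact: ipC.
  by apply: (ip_gt0 hip); rewrite -(linear0 f) (inj_eq (can_inj fK)).
- apply: contraNneq A0 => A'0; apply/eqP/lfunP => v.
  by rewrite -(gK v) -fA A'0 !zero_lfunE linear0.
- by move=> u v; rewrite !fA skew.
by move=> u v; apply: (can_inj fK); rewrite linearZ /= !fbr !fA fbr Abr.
Qed.

(** The infinitesimal rotation in the plane of the coordinates a and b. *)
Definition rot_mx q (a b : nat) : 'M[R]_q :=
  \matrix_(i, j) ((i == a :> nat)%:R * (j == b :> nat)%:R
                  - (i == b :> nat)%:R * (j == a :> nat)%:R).

Lemma rot_mx_skew q a b : (rot_mx q a b)^T = - rot_mx q a b.
Proof. by apply/matrixP => i j; rewrite !mxE; ring. Qed.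

Lemma co_rot q a b (x : 'rV[R]_q) c : (c < q)%N ->
  co (x *m rot_mx q a b) c = co x a * (c == b)%:R - co x b * (c == a)%:R.
Proof.
move=> lt; rewrite (coE _ (Ordinal lt)) mxE /co !mulr_suml -sumrB.
by apply: eq_bigr => i _; rewrite mxE /=; ring.
Qed.

(** For the standard inner product; T acts on the z_k and S on the e_i. *)
Lemma model_killing_operator s p (S : 'M[R]_s.1) (T : 'M[R]_p) :
  S^T = - S -> T^T = - T -> T != 0 ->
  (forall x y : 'rV[R]_s.1,
     (\row_k sform (nth [::] s.2 k) x y) *m T
     = 3 *: \row_k sform (nth [::] s.2 k) (x *m S) y) ->
  exists ip, exists A : 'End(model R s p), killing_operator ip A.
Proof.
move=> ST TT T0 H; pose m := model R s p.
pose ip (u v : m) : R := (u.1 *m v.1^T) 0 0 + (u.2 *m v.2^T) 0 0.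
pose f (u : m) : m := (u.1 *m S, u.2 *m T).
have fl : linear f by move=> c u v; rewrite /f /= !mulmxDl -!scalemxAl.
pose L := GRing.isLinear.Build R m m *:%R f fl.
pose A : 'End(m) := linfun (HB.pack f L : {linear m -> m}).
have AE u : A u = (u.1 *m S, u.2 *m T) by rewrite lfunE.
have sq q (x : 'rV[R]_q) : (x *m x^T) 0 0 = \sum_i x 0 i ^+ 2.
  by rewrite mxE; apply: eq_bigr => i _; rewrite mxE.
exists ip, A; split.
- split.
  + split=> w c u v; rewrite /ip /= ?linearP /= ?mulmxDl ?mulmxDr -?scalemxAl -?scalemxAr !mxE; ring.
  + move=> u v; rewrite /ip; congr (_ + _); rewrite !mxE; apply: eq_bigr => i _;
      by rewrite !mxE mulrC.
  move=> u u0; rewrite /ip !sq lt_neqAle addr_ge0 ?sumr_ge0 // => [|i _|i _]; rewrite ?sqr_ge0 //.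
  rewrite andbT eq_sym; apply: contraNneq u0 => /eqP.
  rewrite paddr_eq0 ?sumr_ge0 // => [|i _|i _]; rewrite ?sqr_ge0 //.
  rewrite !psumr_eq0 => [|i _|i _]; rewrite ?sqr_ge0 //.
  case: u => x t /= /andP[/allP x0 /allP t0]; apply/eqP; congr pair; apply/rowP => i;
    rewrite mxE; apply/eqP; rewrite -sqrf_eq0.
    exact: x0 (mem_index_enum i).
  exact: t0 (mem_index_enum i).
- apply: contraNneq T0 => A0; apply/eqP/row_matrixP => i; rewrite row0 rowE.
  by have := AE (0, delta_mx 0 i); rewrite A0 zero_lfunE => -[_ <-].
- move=> u v; rewrite !AE /ip /= !trmx_mul ST TT !mulNmx !mulmxN !mulmxA !mxE.
  by rewrite opprD !opprK.
by move=> u v; rewrite !AE /= /model_br /= H mul0mx; congr pair; rewrite /= scaler0.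
Qed.

(** The last two z_k are not hit by any bracket. *)
Lemma model_killing_ab s p : (size s.2 + 2 <= p)%N ->
  exists ip, exists A : 'End(model R s p), killing_operator ip A.
Proof.
move=> sp; apply: (@model_killing_operator s p 0 (rot_mx p p.-2 p.-1)).
- by rewrite trmx0 oppr0.
- exact: rot_mx_skew.
- have p2 : (p.-2 < p)%N by lia. have p1 : (p.-1 < p)%N by lia.
  apply/eqP => /matrixP/(_ (Ordinal p2) (Ordinal p1)); rewrite !mxE /= !eqxx.
  rewrite (_ : (p.-2 == p.-1) = false) ?mul0r ?mul1r ?subr0; last by lia.
  by move/eqP; rewrite oner_eq0.
move=> x y; apply: co_inj => a ap; rewrite co_rot // coZ mulmx0.
rewrite !(co_row (fun k => sform (nth [::] s.2 k) x y)); try by lia.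
rewrite (co_row (fun k => sform (nth [::] s.2 k) 0 y)) //.
have E k : (size s.2 <= k)%N -> sform (nth [::] s.2 k) x y = 0.
  by move=> ge; rewrite nth_default // /sform big_nil.
rewrite !E; try by lia.
by rewrite /sform big1 => [|ab _]; rewrite ?co0; ring.
Qed.

(** Multiplication by i on the generators and by 3 i on the brackets. *)
Lemma model_killing_h3C p : (2 <= p)%N ->
  exists ip, exists A : 'End(model R sh_h3C p), killing_operator ip A.
Proof.
move=> p2.
apply: (@model_killing_operator sh_h3C p (rot_mx 4 0 1 + rot_mx 4 2 3) (3 *: rot_mx p 0 1)).
- by rewrite linearD /= !rot_mx_skew opprD.
- by rewrite linearZ /= rot_mx_skew scalerN.
- have p0 : (0 < p)%N by lia.
  apply/eqP => /matrixP/(_ (Ordinal p0) (Ordinal p2)); rewrite !mxE /= !mul1r mul0r subr0 mulr1.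
  by move/eqP; rewrite pnatr_eq0.
move=> x y; apply: co_inj => a ap; rewrite -scalemxAr !coZ co_rot //.
rewrite !(co_row (fun k => sform (nth [::] sh_h3C.2 k) x y)); try by lia.
rewrite (co_row (fun k => sform (nth [::] sh_h3C.2 k) _ y)) //.
case: a ap => [|[|a]] ap; rewrite /= ?nth_nil /sform ?big_cons ?big_nil /= ?mulmxDr ?coD ?co_rot //=; ring.
Qed.


Lemma co_inord q (x : 'rV[R]_q.+1) a : (a <= q)%N -> co x a = x 0 (inord a).
Proof. by move=> le; rewrite -coE inordK. Qed.

Definition split_row q p (x : 'rV[R]_(q + p)) : 'rV[R]_q * 'rV[R]_p :=
  (\row_i co x i, \row_k co x (q + k)).

Lemma split_row_linear q p : linear (@split_row q p).
Proof.
by move=> c x y; congr pair; apply/rowP => i; rewrite !mxE coD coZ.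
Qed.

Lemma split_row_inj q p : injective (@split_row q p).
Proof.
move=> x y [/rowP E1 /rowP E2]; apply: co_inj => a lt.
have [aq | qa] := ltnP a q; first by have := E1 (Ordinal aq); rewrite !mxE.
have kp : (a - q < p)%N by lia.
by have := E2 (Ordinal kp); rewrite !mxE /= subnKC.
Qed.

Lemma co_delta_inord q i a : (i <= q)%N ->
  co (delta_mx 0 (inord i) : 'rV[R]_q.+1) a = (i == a)%:R.
Proof. by move=> le; rewrite co_delta inordK. Qed.

Lemma h3_model : lie_iso (h3 R) (model R sh_h3 1).
Proof.
pose L := GRing.isLinear.Build R (h3 R) (model R sh_h3 1) *:%R _ (@split_row_linear 2 1).
pose f : {linear h3 R -> model R sh_h3 1} := HB.pack (@split_row 2 1) L.
apply: (@lie_iso_inj _ _ _ f).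
- exact: split_row_inj.
- by rewrite model_dim /lie_dim dimvf /dim.
move=> x y; congr pair; apply/rowP => -[i lt]; rewrite !mxE coZ co_delta_inord //=.
  by case: i lt => [|[|]] // _; rewrite mulr0.
case: i lt => [|] // _; rewrite mulr1 /sform big_seq1 /=.
have E0 (w : 'rV[R]_3) : w 0 0 = co w 0.
  by rewrite co_inord //; congr (w 0 _); apply: val_inj; rewrite /= inordK.
have E1 (w : 'rV[R]_3) : w 0 1 = co w 1.
  by rewrite co_inord //; congr (w 0 _); apply: val_inj; rewrite /= inordK.
by rewrite !E0 !E1 (co_row (co x)) // (co_row (co x)) // (co_row (co y)) // (co_row (co y)).
Qed.

Lemma h3C_model : lie_iso (h3C R) (model R sh_h3C 2).
Proof.
pose L := GRing.isLinear.Build R (h3C R) (model R sh_h3C 2) *:%R _ (@split_row_linear 4 2).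
pose f : {linear h3C R -> model R sh_h3C 2} := HB.pack (@split_row 4 2) L.
apply: (@lie_iso_inj _ _ _ f).
- exact: split_row_inj.
- by rewrite model_dim /lie_dim dimvf /dim.
move=> x y; congr pair; apply/rowP => -[i lt]; rewrite !mxE coD !coZ !co_delta_inord //=.
  by case: i lt => [|[|[|[|]]]] // _; rewrite !mulr0 addr0.
case: i lt => [|[|]] // _; rewrite /sform !big_cons big_nil /=;
  rewrite !(co_row (co x)) // !(co_row (co y)) // -!co_inord //; ring.
Qed.

End Constructions.

(** * The fourteen classes *)

Section Final.
Variable R : realType.

Definition admissible (n : lieAlgebra R) : Prop :=
  [/\ two_step n, (lie_dim n <= 8)%N & has_left_invariant_killing_2form n].

Definition class_list : seq (lie_shape * nat) :=
  [:: (sh_h3, 3); (sh_h3, 4); (sh_h3C, 2); (sh_h3C, 3); (sh_h3, 5); (sh_q3, 4);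
      (sh_h5, 3); (sh_h3, 6); (sh_q3, 5); (sh_f3, 5); (sh_h5, 4); (sh_h3h3, 4);
      (sh_jet, 4); (sh_h3C, 4)]%N.

Definition class_model (c : lie_shape * nat) : lieAlgebra R := model R c.1 c.2.

Lemma class_listP s p : (s, p) \in class_list <->
  [/\ s \in shapes, (s.1 + p <= 8)%N &
      (size s.2 + 2 <= p)%N || (s == sh_h3C) && (2 <= p)%N].
Proof.
split.
  move=> H; have : all (fun c => [&& c.1 \in shapes, c.1.1 + c.2 <= 8 &
    (size c.1.2 + 2 <= c.2) || (c.1 == sh_h3C) && (2 <= c.2)])%N class_list by [].
  by move/allP/(_ _ H)/and3P.
case; rewrite !inE => /or4P[||| /or4P[]] /eqP -> /= le8; rewrite ?orbF ?orbT => ge;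
  have : p \in iota 0 7 by rewrite mem_iota; lia.
all: rewrite -[iota 0 7]/[:: 0; 1; 2; 3; 4; 5; 6]%N 7!inE => pI.
all: by move: pI le8 ge; do 6! (case/predU1P => [-> //|]); move=> /eqP ->.
Qed.

Lemma admissibleP n : admissible n <->
  exists2 c, c \in class_list & lie_iso n (class_model c).
Proof.
split=> [[n2 n8 [ip hip [al [Kil li nz]]]] | [[s p] /class_listP[sS le8 sp] iso]].
  have [A kA] := killing_form_operator n2 hip Kil li nz.
  have qE := corankE n; rewrite -/(lie_dim n) in qE.
  have [dZ | [iso dZ]] := killing_dichotomy n2 kA n8.
    have [|s [sS iso sd]] := classify n2; first by lia.
    exists (s, \dim (centerv n)) => //; apply/class_listP; split=> //.
      by rewrite -(model_dim R) -(lie_iso_dim iso).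
    by apply/orP; left; lia.
  exists (sh_h3C, \dim (centerv n)) => //; apply/class_listP; split=> //.
    by rewrite -(model_dim R) -(lie_iso_dim iso).
  by rewrite eqxx; case/andP: dZ => ->; rewrite orbT.
have sp' : (size s.2 <= p)%N.
  by case/orP: sp => [|/andP[/eqP ->]] //; lia.
have n2 : two_step n := lie_iso_two_step (lie_iso_sym iso) (model_two_step R sS sp').
split=> //; first by rewrite (lie_iso_dim iso) model_dim.
have [ip [A kA]] : exists ip, exists A : 'End(model R s p), killing_operator ip A.
  case/orP: sp => [|/andP[/eqP -> p2]]; first exact: model_killing_ab.
  exact: model_killing_h3C.
have [ip' [A' kA']] := killing_operator_iso iso kA.
exact: operator_killing_form kA'.
Qed.

Lemma in_N_model k h : in_N k h -> (k <= 6)%N -> exists s, exists p,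
  [/\ s \in shapes, (size s.2 <= p)%N, (s.1 + p)%N = k & lie_iso h (model R s p)].
Proof.
move=> [h2 dh] k6; have qE := corankE h; rewrite -/(lie_dim h) in qE.
have dZ := dimvS (derived_center h2).
have [|s [sS iso sd]] := classify h2; first by lia.
exists s, (\dim (centerv h)); split=> //; first exact: leq_trans sd dZ.
by rewrite -(model_dim R) -(lie_iso_dim iso).
Qed.

Lemma model_in_N s p k : s \in shapes -> (size s.2 <= p)%N -> (s.1 + p)%N = k ->
  in_N k (model R s p).
Proof. by move=> sS sp <-; split; [exact: model_two_step | exact: model_dim]. Qed.

Lemma sum_ab_iso (h : lieAlgebra R) k s p : (size s.2 <= p)%N -> lie_iso h (model R s p) ->
  lie_iso (lie_sum (lie_ab R k) h) (model R s (p + k)).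
Proof.
move=> sp iso; apply: lie_iso_trans (sum_ab_model R k sp).
exact: lie_sum_iso (lie_iso_refl _) iso.
Qed.

End Final.

Theorem theorem4p14 (R : realType) :
  let admissible (n : lieAlgebra R) :=
    [/\ two_step n, (lie_dim n <= 8)%N & has_left_invariant_killing_2form n] in
  iso_classes_eq admissible 14 /\
  (forall n : lieAlgebra R, admissible n <->
    [\/ lie_dim n = 5 /\ lie_iso n (lie_sum (lie_ab R 2) (h3 R)),
        lie_dim n = 6 /\
          (lie_iso n (lie_sum (lie_ab R 3) (h3 R)) \/ lie_iso n (h3C R)),
        lie_dim n = 7 /\
          (lie_iso n (lie_sum (lie_ab R 1) (h3C R)) \/
           exists h : lieAlgebra R,
             in_N 5 h /\ lie_iso n (lie_sum (lie_ab R 2) h)) |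
        lie_dim n = 8 /\
          exists h : lieAlgebra R,
            in_N 6 h /\ lie_iso n (lie_sum (lie_ab R 2) h)]).
Proof.
move=> adm; split.
  exists (fun i : 'I_14 => class_model R (nth (sh_h3, 0) class_list i)%N); split.
    move=> i j iso; apply/val_inj/eqP.
    have lt (k : 'I_14) : (k < size class_list)%N := ltn_ord k.
    rewrite -(@nth_uniq _ (sh_h3, 0)%N class_list _ _ (lt i) (lt j)) //.
    have := mem_nth (sh_h3, 0)%N (lt i); have := mem_nth (sh_h3, 0)%N (lt j).
    move: iso; case: (nth _ _ i) => s p; case: (nth _ _ j) => s' p' iso H' H.
    have [sS _ sp] := (class_listP s p).1 H.
    have [sS' _ sp'] := (class_listP s' p').1 H'.
    have le t q : (size t.2 + 2 <= q)%N || (t == sh_h3C) && (2 <= q)%N ->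
        (size t.2 <= q)%N.
      by case/orP => [|/andP[/eqP ->]] //; lia.
    by have [-> ->] := model_iso_inj sS sS' (le _ _ sp) (le _ _ sp') iso.
  move=> n; apply: iff_trans (admissibleP n) _; split=> [[c cL iso] | [i iso]].
    have lt : (index c class_list < 14)%N by rewrite index_mem.
    by exists (Ordinal lt); rewrite /= nth_index.
  exists (nth (sh_h3, 0) class_list i)%N; last exact: iso.
  by apply: mem_nth; exact: ltn_ord i.
move=> n; have sum_model k s p h : (size s.2 <= p)%N -> lie_iso h (model R s p) ->
    lie_iso n (lie_sum (lie_ab R k) h) <-> lie_iso n (model R s (p + k)).
  move=> sp /(sum_ab_iso k sp) iso; split=> nI; first exact: lie_iso_trans nI iso.
  exact: lie_iso_trans nI (lie_iso_sym iso).
have h3_sum k := sum_model k sh_h3 1%N (h3 R) isT (h3_model R).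
have h3C_sum k := sum_model k sh_h3C 2%N (h3C R) isT (h3C_model R).
split=> [/admissibleP[[s p] + iso] |].
  have dE : lie_dim n = (s.1 + p)%N by rewrite (lie_iso_dim iso) model_dim.
  have N_sum k : s \in shapes -> (size s.2 + 2 <= p)%N -> (s.1 + p = k + 2)%N ->
      exists h : lieAlgebra R, in_N k h /\ lie_iso n (lie_sum (lie_ab R 2) h).
    move=> sS sp E; exists (model R s (p - 2)); split.
      by apply: model_in_N => //; lia.
    have sp' : (size s.2 <= p - 2)%N by lia.
    apply/(sum_model 2 s (p - 2)%N _ sp' (lie_iso_refl _)).
    by rewrite subnK //; apply: leq_trans sp; rewrite leq_addl.
  rewrite !inE => cL; move: cL iso dE N_sum.
  case/predU1P => [[-> ->] iso dE N_sum|].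
    by apply: Or41; split=> //; apply/h3_sum.
  case/predU1P => [[-> ->] iso dE N_sum|].
    by apply: Or42; split=> //; left; apply/h3_sum.
  case/predU1P => [[-> ->] iso dE N_sum|].
    by apply: Or42; split=> //; right; apply: lie_iso_trans iso (lie_iso_sym (h3C_model R)).
  case/predU1P => [[-> ->] iso dE N_sum|].
    by apply: Or43; split=> //; left; apply/h3C_sum.
  case/predU1P => [[-> ->] iso dE N_sum|].
    by apply: Or43; split=> //; right; apply: N_sum.
  case/predU1P => [[-> ->] iso dE N_sum|].
    by apply: Or43; split=> //; right; apply: N_sum.
  case/predU1P => [[-> ->] iso dE N_sum|].
    by apply: Or43; split=> //; right; apply: N_sum.
  case/predU1P => [[-> ->] iso dE N_sum|].
    by apply: Or44; split=> //; apply: N_sum.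
  case/predU1P => [[-> ->] iso dE N_sum|].
    by apply: Or44; split=> //; apply: N_sum.
  case/predU1P => [[-> ->] iso dE N_sum|].
    by apply: Or44; split=> //; apply: N_sum.
  case/predU1P => [[-> ->] iso dE N_sum|].
    by apply: Or44; split=> //; apply: N_sum.
  case/predU1P => [[-> ->] iso dE N_sum|].
    by apply: Or44; split=> //; apply: N_sum.
  case/predU1P => [[-> ->] iso dE N_sum|].
    by apply: Or44; split=> //; apply: N_sum.
  by move=> /eqP[-> ->] iso dE N_sum; apply: Or44; split=> //; apply: N_sum.
have adm_model s p : (s, p) \in class_list -> lie_iso n (model R s p) -> adm n.
  by move=> cL iso; apply/admissibleP; exists (s, p).
have adm_sum k h : (k <= 6)%N -> in_N k h -> lie_iso n (lie_sum (lie_ab R 2) h) -> adm n.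
  move=> k6 /in_N_model/(_ k6)[s [p [sS sp E hI]]] /(sum_model 2 s p h sp hI).
  apply: adm_model; apply/class_listP; split=> //; first by lia.
  by rewrite leq_add2r sp.
case=> [[_ /h3_sum]|[_ [/h3_sum|]]|[_ [/h3C_sum|[h [hN]]]]|[_ [h [hN]]]].
- exact: adm_model.
- exact: adm_model.
- by move=> /lie_iso_trans/(_ (h3C_model R)); apply: adm_model.
- exact: adm_model.
- exact: adm_sum hN.
exact: adm_sum hN.
Qed.
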